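(* Let $\vec G=(V,E)$ be a connected directed graph on a linearly ordered edge set $E$ which is bipolar with respect to $p=\min(E)$, and let $r$ be the number of edges of a spanning tree of $G$. Run the following algorithm. (1) Let $p<f_2<\dots<f_r$ be the lexicographically smallest spanning tree of $G$ (with respect to the order on $E$), and initialize the current optimizable digraph as $\vec G$ itself with infinity edge $p$, ground set $E$ and objective set $F=\{f_2<\dots<f_r\}$. (2) For $i=2,\dots,r$: (2.1) let $C_{\mathrm{opt}}$ be the optimal cocycle of the current optimizable digraph $\vec G$ (with infinity edge $p$, ground set $E$, objective set $F$); (2.2) let $t_i=\min(E\setminus C_{\mathrm{opt}})$; (2.3) let $p'=t_i$; (2.4) let $E'=E\setminus C_{\mathrm{opt}}$; (2.5) if $p'\in F$ let $F'=F\setminus\{p'\}$; if $p'\notin F$ let $F'=F\setminus\{\max(F\cap C_G(F\cup\{p\};p'))\}$, where $C_G(F\cup\{p\};p')$ is the fundamental cycle of $p'$ with respect to the spanning tree $F\cup\{p\}$ of the current graph $G$; (2.6) let $\vec G'$ be the digraph obtained from the current $\vec G$ by deleting all edges not in $E'\cup F'\cup\{p\}$ and then contracting $p$, regarded as an optimizable digraph with infinity edge $p'$, ground set $E'$ and objective set $F'$ (ordered by the order of the original $E$); (2.7) replace $\vec G,p,E,F$ by $\vec G',p',E',F'$. (3) Output $\{p,t_2,\dots,t_r\}$. Then the output $\{p<t_2<\dots<t_r\}$ is exactly the fully optimal spanning tree $\alpha(\vec G)$ of $\vec G$.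
   Context: Graphs are finite and connected, loops and multiple edges allowed; cycles and cocycles (inclusion-minimal nonempty edge cuts) are regarded as edge subsets. For a spanning tree $T$ and $t\in T$, the fundamental cocycle $C^*(T;t)$ is the unique cocycle contained in $(E\setminus T)\cup\{t\}$; for $e\notin T$ the fundamental cycle $C(T;e)$ is the unique cycle contained in $T\cup\{e\}$. In a digraph, a cycle gives two opposite signed cycles (fix a traversal direction; edges traversed forward are positive, backward negative), and a cocycle, being the set of edges between the sides of a vertex bipartition $(X,V\setminus X)$, gives two opposite signed cocycles (edges from $X$ to $V\setminus X$ positive, the others negative). A fundamental cycle $C(T;e)$ (resp. cocycle $C^*(T;t)$) is signed so that $e$ (resp. $t$) is positive. A directed cocycle is one whose edges all have the same sign. A digraph with edge set $E$ is bipolar with respect to $p\in E$ if it is acyclic and has a unique source and a unique sink, which are the two endpoints of $p$ (a digraph consisting of a single isthmus edge $p$ is bipolar w.r.t. $p$). For $\vec G$ on a linearly ordered edge set $E$, bipolar w.r.t. $p=\min(E)$, its fully optimal spanning tree $\alpha(\vec G)$ is the unique spanning tree $T$ of $G$ such that for every $b\in T\setminus\{p\}$, $b$ and $\min(C^*(T;b))$ have opposite signs in $C^*(T;b)$, and for every $e\in E\setminus T$, $e$ and $\min(C(T;e))$ have opposite signs in $C(T;e)$ (existence and uniqueness of such $T$ is a known theorem). An optimizable digraph is a connected digraph with edge set $E\cup F$ (possibly $E\cap F\neq\emptyset$), together with an edge $p\in E\setminus F$ (infinity edge), a ground set $E$ such that the subdigraph $\vec G(E)$ restricted to the edges of $E$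 is acyclic, and a linearly ordered objective set $F$ such that $F\cup\{p\}$ is a spanning tree of $G$. Signed cocycles of $\vec G$ containing $p$ are linearly ordered as follows: for distinct such $C,D$, let $f$ be the smallest element of $F$ that either lies in the symmetric difference $C\triangle D$ or lies in $C\cap D$ with opposite signs in $C$ and $D$; set $C>D$ if $f$ is positive in $C$ or negative in $D$, and $D>C$ otherwise. (Equivalently, writing $F=\{f_2<\dots<f_r\}$, give $f_i$ weight $2^{r-i}$ if positive and $-2^{r-i}$ if negative in a signed cocycle, elements outside $F$ weight $0$, and compare total weights.) The optimal cocycle is the maximum, in this order, among signed cocycles $C$ of $\vec G$ containing $p$ with $p$ positive and with all elements of $C\cap E$ positive (i.e. inducing a directed cocycle of $\vec G(E)$). *)

(* Defs.v *)
From Stdlib Require Import ClassicalEpsilon.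
From HB Require Import structures.
From mathcomp Require Import all_boot.

Set Implicit Arguments.
Unset Strict Implicit.
Unset Printing Implicit Defensive.

(* Edges are 'I_m, linearly ordered by the natural order on ordinals.
   Vertices are a finType V.  Loops and multiple edges are allowed.    *)

Section Graphs.
Variables (V : finType) (m : nat).
Local Notation edge := 'I_m.

Record digraph := Digraph {
  vset : {set V};
  eset : {set edge};
  tailv : edge -> V;
  headv : edge -> V }.

Definition adj (G : digraph) (A : {set edge}) : rel V :=
  fun x y => [exists e in A,
    ((tailv G e == x) && (headv G e == y)) || ((headv G e == x) && (tailv G e == y))].

Definition connected_by (G : digraph) (A : {set edge}) : Prop :=
  forall x y, x \in vset G -> y \in vset G -> connect (adj G A) x y.

Definition connected (G : digraph) : Prop := connected_by G (eset G).

(* Signed edge sets: (positive part, negative part). *)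
Definition sset := ({set edge} * {set edge})%type.
Definition supp (C : sset) : {set edge} := C.1 :|: C.2.

Fixpoint walk_ok (G : digraph) (C : sset) (x : V) (s : seq (edge * V)) : bool :=
  if s is (e, y) :: s' then
    (((e \in C.1) && (tailv G e == x) && (headv G e == y))
     || ((e \in C.2) && (headv G e == x) && (tailv G e == y)))
    && walk_ok G C y s'
  else true.

Definition signed_cycle (G : digraph) (C : sset) : Prop :=
  exists (x : V) (s : seq (edge * V)),
    [/\ s != [::], walk_ok G C x s, last x (map snd s) = x,
        uniq (map fst s) & uniq (map snd s)] /\
    [/\ supp C = [set e | e \in map fst s], [disjoint C.1 & C.2]
      & supp C \subset eset G].

Definition cycle (G : digraph) (D : {set edge}) : Prop :=
  exists C, signed_cycle G C /\ supp C = D.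

Definition cut (G : digraph) (X : {set V}) : {set edge} :=
  [set e in eset G | (tailv G e \in X) != (headv G e \in X)].

Definition is_cut (G : digraph) (D : {set edge}) : Prop :=
  exists X : {set V}, X \subset vset G /\ D = cut G X.

Definition cocycle (G : digraph) (D : {set edge}) : Prop :=
  [/\ D != set0, is_cut G D &
      forall D', is_cut G D' -> D' != set0 -> D' \subset D -> D' = D].

Definition signed_cocycle (G : digraph) (C : sset) : Prop :=
  exists X : {set V}, [/\ X \subset vset G, cocycle G (cut G X) &
    C = ([set e in eset G | (tailv G e \in X) && (headv G e \notin X)],
         [set e in eset G | (headv G e \in X) && (tailv G e \notin X)])].

Definition spanning_tree (G : digraph) (T : {set edge}) : Prop :=
  [/\ T \subset eset G, connected_by G T &
      forall D, cycle G D -> ~ D \subset T].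

Definition acyclic (G : digraph) : Prop :=
  forall C, signed_cycle G C -> C.1 != set0 /\ C.2 != set0.

Definition is_source (G : digraph) (v : V) : Prop :=
  forall e, e \in eset G -> headv G e != v.
Definition is_sink (G : digraph) (v : V) : Prop :=
  forall e, e \in eset G -> tailv G e != v.

(* bipolar w.r.t. p: acyclic, unique source and unique sink, which are
   the endpoints of p (necessarily the source is the tail of p). *)
Definition bipolar (G : digraph) (p : edge) : Prop :=
  [/\ p \in eset G, acyclic G,
      forall v, v \in vset G -> (is_source G v <-> v = tailv G p) &
      forall v, v \in vset G -> (is_sink G v <-> v = headv G p)].

Definition is_min (A : {set edge}) (e : edge) : Prop :=
  e \in A /\ forall g, g \in A -> (e <= g)%N.

Definition fully_optimal (G : digraph) (p : edge) (T : {set edge}) : Prop :=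
  [/\ spanning_tree G T,
      (forall b C, b \in T -> b != p -> signed_cocycle G C ->
          supp C \subset (eset G :\: T) :|: [set b] -> b \in C.1 ->
          exists2 f, f \in C.2 & is_min (supp C) f) &
      (forall e C, e \in eset G :\: T -> signed_cycle G C ->
          supp C \subset T :|: [set e] -> e \in C.1 ->
          exists2 f, f \in C.2 & is_min (supp C) f)].

Fixpoint lex_le (s t : seq nat) : bool :=
  match s, t with
  | [::], _ => true
  | _ :: _, [::] => false
  | x :: s', y :: t' => (x < y) || ((x == y) && lex_le s' t')
  end.

Definition sorted_edges (A : {set edge}) : seq nat :=
  sort leq [seq val e | e <- enum A].

Definition lexmin_spanning_tree (G : digraph) (T : {set edge}) : Prop :=
  spanning_tree G T /\
  forall T', spanning_tree G T' -> lex_le (sorted_edges T) (sorted_edges T').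

Definition differ (C D : sset) (f : edge) : bool :=
  ((f \in supp C) != (f \in supp D))
  || ((f \in C.1) && (f \in D.2)) || ((f \in C.2) && (f \in D.1)).

Definition cocycle_gt (F : {set edge}) (C D : sset) : Prop :=
  exists f, [/\ f \in F, differ C D f,
    forall g, g \in F -> (g < f)%N -> ~~ differ C D g &
    (f \in C.1) || (f \in D.2)].

Definition admissible (G : digraph) (p : edge) (E : {set edge}) (C : sset) : Prop :=
  [/\ signed_cocycle G C, p \in C.1 & [disjoint C.2 & E]].

Definition is_optimal_cocycle (G : digraph) (p : edge) (E F : {set edge})
  (C : sset) : Prop :=
  admissible G p E C /\
  forall D, admissible G p E D -> D <> C -> cocycle_gt F C D.

(* the optimal cocycle (chosen; it exists uniquely under the hypotheses) *)
Definition opt_cocycle (G : digraph) (p : edge) (E F : {set edge}) : sset :=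
  epsilon (inhabits (set0, set0)) (is_optimal_cocycle G p E F).

Definition fund_cycle (G : digraph) (T : {set edge}) (e : edge) : {set edge} :=
  epsilon (inhabits set0) (fun D => cycle G D /\ D \subset T :|: [set e]).

(* min / max of a (nonempty) edge set; d is an unused default *)
Definition smin (A : {set edge}) (d : edge) : edge :=
  odflt d [pick x in A | [forall y in A, (x <= y)%N]].
Definition smax (A : {set edge}) (d : edge) : edge :=
  odflt d [pick x in A | [forall y in A, (y <= x)%N]].

Section Base.
Variables (tl hd : edge -> V).

Definition G0 : digraph := Digraph [set: V] [set: edge] tl hd.

(* Minors: contract the edges of K (in the original graph), keep the
   edges of S.  A vertex of the minor is a class of vertices connected
   by K, represented by its canonical root. *)
Definition cls (K : {set edge}) (v : V) : V := root (adj G0 K) v.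

Definition minor (K S : {set edge}) : digraph :=
  Digraph [set cls K v | v : V] S (fun e => cls K (tl e)) (fun e => cls K (hd e)).

(* The algorithm: the current optimizable digraph is the minor
   (K contracted, edge set E :|: F), infinity edge p, ground set E,
   objective set F.  Returns the list [t_i; t_(i+1); ...]. *)
Fixpoint run (n : nat) (K : {set edge}) (p : edge) (E F : {set edge}) : seq edge :=
  match n with
  | 0 => [::]
  | n'.+1 =>
    let G := minor K (E :|: F) in
    let Copt := opt_cocycle G p E F in
    let t := smin (E :\: supp Copt) p in
    let p' := t in
    let E' := E :\: supp Copt in
    let F' := if p' \in F then F :\ p'
              else F :\ smax (F :&: fund_cycle G (F :|: [set p]) p') p' in
    (* delete edges outside E' \cup F' \cup {p}, then contract p *)
    t :: run n' (p |: K) p' E' F'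
  end.

Definition T0 : {set edge} := epsilon (inhabits set0) (lexmin_spanning_tree G0).

Definition alg_ts (p : edge) : seq edge :=
  run (#|T0|).-1 set0 p [set: edge] (T0 :\ p).

End Base.
End Graphs.

(* Main.v *)
Require Import Defs.
From Stdlib Require Import Classical ClassicalEpsilon.
From HB Require Import structures.
From mathcomp Require Import all_boot all_order all_algebra.
From mathcomp Require Import zify.

(* Let X_i be the shore of the i-th optimal cocycle.  The cut of X_i avoids t_1, ..., t_(i-1),
   since these edges are contracted, and t_(i+1), ..., t_r, since these are chosen outside it;
   so the X_i yield the fundamental cocycles of the output T.  The sign condition on fundamental
   cycles follows: an edge e leaves the ground set at the first i for which e lies in the cut of
   X_i, and it is positive there, while t_i was the least element of the ground set.

   The sign condition on fundamental cocycles rests on optimality.  The objective set F stays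
   the lexicographically smallest tree of the contracted graph, so the least edge of any cut
   avoiding the contracted edges lies in F.  Invariant: a nonempty cut avoiding the contracted
   edges and p, and nonnegative on the ground set, has a negative least edge.  At the start
   there is no such cut, by bipolarity.  If after a step some cut Z violated it, the level sets
   of 1_X + 1_Z, with X the optimal shore, would provide one cut through p and one cut avoiding p;
   the invariant, applied to the latter, makes the former better than X. *)

Set Implicit Arguments.
Unset Strict Implicit.
Unset Printing Implicit Defensive.

Import Order.TTheory GRing.Theory Num.Theory.

(** * Cycles and cuts *)

Section Cuts.
Variables (V : finType) (m : nat).
Implicit Types (G : digraph V m) (A B K F S : {set 'I_m}) (X Y Z W : {set V}).
Implicit Types (e f g : 'I_m) (C : sset m).

(** * Coboundaries of vertex sets *)

Section Coboundary.
Variables (t h : 'I_m -> V).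

(* Coboundary of the indicator function of [X]: [1] on edges leaving [X], [-1] on edges entering. *)
Definition coboundary X e : int :=
  (nat_of_bool (t e \in X))%:Z - (nat_of_bool (h e \in X))%:Z.
Local Notation cob := coboundary.

(** Cuts of a contraction by [K] are represented by vertex sets of the original graph that satisfy
    [uncut K], so that all stages of the algorithm share one vertex set. *)
Definition uncut A X := [forall e in A, cob X e == 0].
Definition nonneg A X := [forall e in A, (0 <= cob X e)%R].

Lemma uncutP A X : reflect (forall e, e \in A -> cob X e = 0) (uncut A X).
Proof. by apply: (iffP (forall_inP)) => H e /H /eqP. Qed.

Lemma nonnegP A X : reflect (forall e, e \in A -> (0 <= cob X e)%R) (nonneg A X).
Proof. exact: forall_inP. Qed.

Lemma cobUI X Y e : (cob (X :|: Y) e + cob (X :&: Y) e = cob X e + cob Y e)%R.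
Proof. by rewrite /coboundary !inE; do 4! case: (_ \in _). Qed.

Lemma cobC X e : (cob (~: X) e = - cob X e)%R.
Proof. by rewrite /coboundary !inE; do 2! case: (_ \in _). Qed.

Lemma cob_bound X e : (-1 <= cob X e)%R && (cob X e <= 1)%R.
Proof. by rewrite /coboundary; do 2! case: (_ \in _). Qed.

(* [X :|: Y] and [X :&: Y] are the level sets of the sum of the two indicator functions. *)
Lemma cob_sum_ge0 X Y e : (0 <= cob X e + cob Y e)%R ->
  (0 <= cob (X :|: Y) e)%R && (0 <= cob (X :&: Y) e)%R.
Proof. by rewrite /coboundary !inE; do 4! case: (_ \in _). Qed.

Lemma cob_sum_eq0 X Y e : (cob X e + cob Y e = 0)%R ->
  cob (X :|: Y) e = 0 /\ cob (X :&: Y) e = 0.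
Proof. by rewrite /coboundary !inE; do 4! case: (_ \in _). Qed.

Lemma uncutUI A X Y : (forall e, e \in A -> cob X e + cob Y e = 0)%R ->
  uncut A (X :|: Y) /\ uncut A (X :&: Y).
Proof. by move=> H; split; apply/uncutP=> e /H /cob_sum_eq0[]. Qed.

Lemma first_cut X e : cob X e != 0 ->
  exists2 f, cob X f != 0 & forall g, (g < f)%N -> cob X g = 0.
Proof.
move=> Xe; case: (@arg_minnP _ e (fun i => cob X i != 0) (@nat_of_ord m) Xe) => f Xf fmin.
exists f => // g gf; apply/eqP/negPn/negP=> /fmin; lia.
Qed.

Lemma uncut_path (r : rel V) X x y : (forall x y, r x y -> (x \in X) = (y \in X)) ->
  connect r x y -> (x \in X) = (y \in X).
Proof. by move=> rX; apply: closed_connect. Qed.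

End Coboundary.

Lemma adj_sym G A : symmetric (adj G A).
Proof.
by move=> x y; apply: eq_existsb => e; rewrite orbC; congr (_ && (_ || _)); rewrite andbC.
Qed.

Lemma adj_uncut G A X x y : uncut (tailv G) (headv G) A X -> adj G A x y ->
  (x \in X) = (y \in X).
Proof.
move=> /uncutP uX /existsP[e /andP[/uX]]; rewrite /coboundary => He.
case/orP=> /andP[/eqP <- /eqP <-]; move: He; by do 2! case: (_ \in X).
Qed.

Lemma connect_uncut G A X x y : uncut (tailv G) (headv G) A X ->
  connect (adj G A) x y -> (x \in X) = (y \in X).
Proof. by move=> uX; apply: uncut_path => {}x {}y; apply: adj_uncut. Qed.

Lemma uncut_connect G A x : uncut (tailv G) (headv G) A [set y | connect (adj G A) x y].
Proof.
apply/uncutP=> e Ae; rewrite /coboundary !inE.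
have th : adj G A (tailv G e) (headv G e) by apply/existsP; exists e; rewrite Ae !eqxx.
have -> : connect (adj G A) x (tailv G e) = connect (adj G A) x (headv G e); last by rewrite subrr.
exact: same_connect_r (sym_connect_sym (@adj_sym G A)) _ _ (connect1 th) _.
Qed.

(** * Walks, and the orthogonality of cycles and cuts *)

Lemma walk_okW G C C' x s :
  (forall f x y, (f, y) \in s -> walk_ok G C x [:: (f, y)] -> walk_ok G C' x [:: (f, y)]) ->
  walk_ok G C x s -> walk_ok G C' x s.
Proof.
elim: s x => // -[e y] s IHs x H1 /=; case/andP=> He Hs.
rewrite IHs // ?andbT; last by move=> f z w fs; apply: H1; rewrite inE fs orbT.
by have := H1 e x y; rewrite inE eqxx /= !andbT; apply.
Qed.

(** Meaningful on the support of [C]: 1 when the traversal of [e] prescribed by [C] leaves [X], -1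
    when it enters [X]. *)
Definition cobt G C X e : int :=
  if e \in C.1 then coboundary (tailv G) (headv G) X e
  else (- coboundary (tailv G) (headv G) X e)%R.

Lemma walk_balance G C X x s : [disjoint C.1 & C.2] -> walk_ok G C x s ->
  (\sum_(e <- map fst s) cobt G C X e = (nat_of_bool (x \in X))%:Z -
    (nat_of_bool (last x (map snd s) \in X))%:Z)%R.
Proof.
move=> dC; elim: s x => [|[e y] s IHs] x /=; first by rewrite big_nil subrr.
case/andP=> He /IHs; rewrite big_cons => ->.
have -> : cobt G C X e = ((nat_of_bool (x \in X))%:Z - (nat_of_bool (y \in X))%:Z)%R; last by lia.
rewrite /cobt; case/orP: He => /andP[/andP[Ce /eqP<-] /eqP<-].
  by rewrite Ce.
by rewrite (disjointFl dC) // /coboundary; lia.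
Qed.

(* A closed walk leaves [X] as often as it enters [X]. *)
Lemma cycle_cut_orthogonal G C X e : signed_cycle G C ->
  e \in supp C -> coboundary (tailv G) (headv G) X e != 0 ->
  exists2 g, g \in supp C & (cobt G C X g = - cobt G C X e)%R.
Proof.
case=> x [s [[s0 Hs lx us _] [sC dC _]]] eC Xe.
have := walk_balance X dC Hs; rewrite /= lx subrr => sum0.
have bnd g : (-1 <= cobt G C X g <= 1)%R.
  by rewrite /cobt; have := cob_bound (tailv G) (headv G) X g; case: ifP; lia.
have ce0 : cobt G C X e != 0 by rewrite /cobt; case: ifP; lia.
(* Without an edge of opposite value, all products with the value at [e] are nonnegative and sum to
   zero, although the product at [e] is a nonzero square. *)
apply: NNPP => Hno.
have ge0 g : g \in map fst s -> (0 <= cobt G C X e * cobt G C X g)%R.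
  move=> gs; have : cobt G C X g <> (- cobt G C X e)%R.
    by move=> Hg; apply: Hno; exists g; rewrite // sC inE.
  have := bnd g; have := bnd e; nia.
have : (\sum_(g <- map fst s | g \in map fst s) cobt G C X e * cobt G C X g == 0)%R.
  by rewrite -big_seq -mulr_sumr sum0 mulr0.
rewrite psumr_eq0 // => /allP/(_ e); rewrite sC inE in eC; rewrite eC => /(_ isT) /=.
by rewrite mulf_eq0 orbb (negbTE ce0).
Qed.

(** Unsigned form for exchange arguments: the edge of opposite value differs from [e], since a
    nonzero integer is not its own opposite. *)
Lemma cycle_cut_orthogonal_neq G C X e : signed_cycle G C ->
  e \in supp C -> coboundary (tailv G) (headv G) X e != 0 ->
  exists g, [/\ g \in supp C, g != e & coboundary (tailv G) (headv G) X g != 0].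
Proof.
move=> cC eC Xe; case: (cycle_cut_orthogonal cC eC Xe) => g gC Hg.
exists g; split=> //.
  by apply/eqP=> eq_ge; move: Hg; rewrite eq_ge /cobt; case: ifP; lia.
by move: Hg; rewrite /cobt; case: (g \in C.1); case: (e \in C.1); lia.
Qed.

(** * Cycles obtained by closing a path *)

Lemma walk_endpoints G C x s f : walk_ok G C x s -> f \in map fst s ->
  (tailv G f \in x :: map snd s) && (headv G f \in x :: map snd s).
Proof.
elim: s x => //= -[e y] s IHs x /andP[/= He Hs]; rewrite !inE => /orP[/eqP->|fs].
  by case/orP: He => /andP[/andP[_ /eqP->] /eqP->]; rewrite !eqxx ?orbT.
by have := IHs _ Hs fs; rewrite !inE => /andP[-> ->]; rewrite !orbT.
Qed.

Lemma walk_edges_uniq G C x s : walk_ok G C x s -> uniq (x :: map snd s) -> uniq (map fst s).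
Proof.
elim: s x => //= -[e y] s IHs x /andP[/= He Hs] /andP[xs us].
rewrite (IHs _ Hs us) andbT; apply/negP=> /(walk_endpoints Hs)/andP[Ht Hh].
by case/orP: He => /andP[/andP[_ /eqP He] _]; rewrite -He ?Ht ?Hh in xs.
Qed.

Lemma path_walk G C (r : rel V) x q :
  (forall x y, r x y -> exists e, walk_ok G C x [:: (e, y)]) ->
  path r x q -> exists2 s, map snd s = q & walk_ok G C x s.
Proof.
move=> rW; elim: q x => [|y q IHq] x /=; first by exists [::].
case/andP=> /rW[e /=]; rewrite andbT => He /IHq[s <- Hs].
by exists ((e, y) :: s) => //=; rewrite He.
Qed.

(** The relation is left abstract in order to cover both undirected and directed paths. *)
Lemma connect_walk G C (r : rel V) x y :
  (forall x y, r x y -> exists e, walk_ok G C x [:: (e, y)]) ->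
  connect r x y -> exists s, [/\ walk_ok G C x s, last x (map snd s) = y & uniq (x :: map snd s)].
Proof.
move=> rW /connectP[q qP ->]; case/shortenP: qP => q' q'P uq _.
by case: (path_walk rW q'P) => s sq Hs; exists s; rewrite Hs sq.
Qed.

Lemma walk_ok_rcons G C x s e y : walk_ok G C x (rcons s (e, y)) =
  walk_ok G C x s && walk_ok G C (last x (map snd s)) [:: (e, y)].
Proof. by elim: s x => //= -[f z] s IHs x; rewrite IHs andbA. Qed.

Lemma walk_mem G C x s f y : walk_ok G C x s -> (f, y) \in s ->
  ((f \in C.1) && (headv G f == y)) || ((f \in C.2) && (tailv G f == y)).
Proof.
elim: s x => //= -[e z] s IHs x /andP[/= He Hs]; rewrite !inE => /orP[/eqP[-> ->]|/(IHs _ Hs)//].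
by case/orP: He => /andP[/andP[-> _] ->]; rewrite ?orbT.
Qed.

(** The parts of [C] may overlap, as in [undirected_cycle], so disjoint signs are read off from the
    walk closed by [e]. *)
Lemma close_walk G C e s : walk_ok G C (headv G e) s ->
  last (headv G e) (map snd s) = tailv G e -> uniq (headv G e :: map snd s) ->
  e \notin map fst s -> e \in eset G -> supp C \subset eset G ->
  exists C', [/\ signed_cycle G C', e \in C'.1, C'.1 \subset e |: supp C & C'.2 \subset C.2].
Proof.
move=> Hs ls us es eG sG.
set s' := rcons s (e, headv G e).
(* Positive edges are those through which the closed walk arrives at their head; a loop thus counts
   as positive. *)
pose C1 := [set f | (f, headv G f) \in s'].
pose C2 := [set f in map fst s' | (f, headv G f) \notin s'].
have Hs' : walk_ok G (e |: C.1, C.2) (headv G e) s'.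
  rewrite walk_ok_rcons ls /= !inE !eqxx /= andbT; apply: walk_okW Hs => f x y fs /=.
  by rewrite !inE; case: (f \in C.1); rewrite ?orbT //= !andbT => ->; rewrite orbT.
have s'1 : map fst s' = rcons (map fst s) e by rewrite map_rcons.
have s'2 : map snd s' = rcons (map snd s) (headv G e) by rewrite map_rcons.
have us'1 : uniq (map fst s').
  by rewrite s'1 rcons_uniq es (walk_edges_uniq Hs us).
have inj f y z : (f, y) \in s' -> (f, z) \in s' -> y = z.
  move=> /(nthP (e, headv G e))[i i_lt Ei] /(nthP (e, headv G e))[j j_lt Ej].
  suff eq_ij : i = j by move: Ej; rewrite -eq_ij Ei => -[].
  apply/eqP; rewrite -(nth_uniq e _ _ us'1) ?size_map //.
  by rewrite !(nth_map (e, headv G e)) // Ei Ej.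
have C1s f : f \in C1 -> f \in map fst s'.
  by rewrite inE => fs; apply/mapP; exists (f, headv G f).
have suppE : supp (C1, C2) = [set f in map fst s'].
  apply/setP=> f; rewrite /supp in_setU /= [f \in C2]inE [RHS]inE.
  by case: (boolP (f \in C1)) => [/C1s-> //|]; rewrite inE /= => ->; rewrite andbT.
have C1C f : f \in C1 -> f \in e |: supp C.
  rewrite inE => /(walk_mem Hs') /=; rewrite !inE.
  by case/orP=> /andP[H _]; move: H; [case/orP=> -> | move->]; rewrite ?orbT.
have C2C f : f \in C2 -> f \in C.2.
  rewrite !inE => /andP[/mapP[[f' y] fs /= ff'] fN]; rewrite -ff' in fs.
  have := walk_mem Hs' fs; rewrite /= => /orP[/andP[_ /eqP yE]|/andP[]//].
  by rewrite yE fs in fN.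
exists (C1, C2); split=> /=; first 1 last.
- by rewrite inE mem_rcons mem_head.
- by apply/subsetP.
- by apply/subsetP.
exists (headv G e), s'; do !split=> //; rewrite ?s'2 ?last_rcons ?rcons_uniq //.
- by rewrite /s'; case: (s).
- apply: walk_okW Hs' => f x y fs /=; rewrite !inE !andbT.
  have fs1 : f \in map fst s' by apply/mapP; exists (f, y).
  case/orP=> /andP[/andP[fC /eqP<-] /eqP yE]; first by rewrite yE fs !eqxx.
  rewrite yE eqxx fs1 !andbT eqxx /=; case: (boolP (_ \in s')) => //= fh.
  by rewrite (inj _ _ _ fs fh) eqxx.
- by rewrite -setI_eq0; apply/eqP/setP=> f; rewrite !inE; case: (_ \in s'); rewrite ?andbF.
- apply/subsetP=> f; rewrite suppE inE s'1 mem_rcons inE => /orP[/eqP->//|/mapP[[f' y] fs /= ->]].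
  by apply: (subsetP sG); have := walk_mem Hs fs; rewrite inE;
    case/orP=> /andP[-> _]; rewrite ?orbT.
Qed.

Lemma undirected_cycle G A e : e \notin A -> e |: A \subset eset G ->
  connect (adj G A) (headv G e) (tailv G e) ->
  exists C, [/\ signed_cycle G C, e \in supp C & supp C \subset e |: A].
Proof.
move=> eA; rewrite subUset sub1set => /andP[eG sAG] /(@connect_walk G (A, A))[].
  move=> x y /existsP[f /andP[fA]] Hf; exists f; rewrite /= fA andbT.
  by case/orP: Hf => /andP[-> ->]; rewrite ?orbT.
move=> s [Hs ls us].
have es : e \notin map fst s.
  apply: contra eA => /mapP[[f y] fs /= ->].
  by have := walk_mem Hs fs => /=; case/orP=> /andP[].
case: (close_walk Hs ls us es) => //; first by rewrite /supp /= setUid.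
rewrite /supp /= setUid => C [cC eC sC1 sC2]; exists C; split=> //; first by rewrite inE eC.
by rewrite subUset sC1 (subset_trans sC2) // subsetUr.
Qed.

Definition dadj G : rel V := fun x y => [exists e in eset G, (tailv G e == x) && (headv G e == y)].

(** A directed path from the head of [e] to its tail would close up to a cycle without negative
    edges. *)
Lemma acyclic_dadj G e : acyclic G -> e \in eset G ->
  ~~ connect (dadj G) (headv G e) (tailv G e).
Proof.
move=> acG eG; apply/negP=> /(@connect_walk G (eset G, set0))[].
  by move=> x y /existsP[f /and3P[fG fx fy]]; exists f; rewrite /= fG fx fy.
move=> s [Hs ls us].
have es : e \notin map fst s.
  apply/negP=> /mapP[[f y] fs /= ef]; rewrite -ef in fs.
  have := walk_mem Hs fs; rewrite /= inE orbF => /andP[_ /eqP yE].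
  by case/andP: us => /negP[]; apply/mapP; exists (e, y).
case: (close_walk Hs ls us es) => //; first by rewrite /supp /= setU0.
move=> C [cC _ _]; rewrite subset0 => /eqP C20; case: (acG _ cC) => _.
by rewrite C20 eqxx.
Qed.

End Cuts.

(** * Spanning trees *)

Lemma lex_le_refl : reflexive lex_le.
Proof. by elim=> //= x s ->; rewrite eqxx orbT. Qed.

Lemma lex_le_trans : transitive lex_le.
Proof.
elim=> [|y s IHs] [|x r] [|z t] //= /orP[xy|/andP[/eqP-> rs]] /orP[yz|/andP[/eqP<- st]].
- by rewrite (ltn_trans xy yz).
- by rewrite xy.
- by rewrite yz.
- by rewrite eqxx (IHs _ _ rs st) orbT.
Qed.

Lemma lex_le_total : total lex_le.
Proof. by elim=> [|x s IHs] [|y t] //=; have := IHs t; case: ltngtP. Qed.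

(** At the first disagreement [t] carries [e] and [s] a larger entry; the last hypothesis keeps [s]
    from ending there, as a prefix counts as smaller. *)
Lemma lex_le_first_diff (s t : seq nat) (e : nat) : sorted ltn s -> sorted ltn t ->
  e \in t -> e \notin s -> {in gtn e, s =i t} -> has (ltn e) s -> ~~ lex_le s t.
Proof.
elim: s t => [|x s IHs] [|y t] //= xs yt et es st_e se.
rewrite negb_or negb_and -leqNgt.
have lt_s z : z \in s -> x < z by move=> /(allP (order_path_min ltn_trans xs)).
have lt_t z : z \in t -> y < z by move=> /(allP (order_path_min ltn_trans yt)).
move: es; rewrite inE negb_or => /andP[ex es].
case: (ltngtP x e) ex => // [xe|ex] _; last first.
  have ye : y <= e by move: et; rewrite inE => /orP[/eqP->//|/lt_t/ltnW].
  by rewrite (leq_trans ye (ltnW ex)) (gtn_eqF (leq_ltn_trans ye ex)).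
have xt : x \in y :: t by rewrite -st_e // mem_head.
have yx : y <= x by move: xt; rewrite inE => /orP[/eqP->//|/lt_t/ltnW].
have ys : y \in x :: s by rewrite st_e ?mem_head // inE; apply: leq_ltn_trans xe.
have {}xy : x = y.
  by apply/eqP; rewrite eqn_leq yx andbT; move: ys; rewrite inE => /orP[/eqP->//|/lt_s/ltnW].
subst y; rewrite leqnn eqxx /=; apply: IHs => //.
- exact: path_sorted xs.
- exact: path_sorted yt.
- by move: et; rewrite inE (gtn_eqF xe).
- move=> z ze; have := st_e z ze; rewrite !inE; case: eqVneq => //= -> _.
  by apply/idP/idP=> [/lt_s|/lt_t]; rewrite ltnn.
- by move: se; rewrite ltnNge (ltnW xe).
Qed.

(** * Spanning trees described by cuts *)

Section Trees.
Variables (V : finType) (m : nat) (tl hd : 'I_m -> V).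
Implicit Types (A B K F S T : {set 'I_m}) (X Y Z W : {set V}).
Implicit Types (e f g : 'I_m) (C : sset m).

Local Notation cob := (coboundary tl hd).
Local Notation uncut := (uncut tl hd).
Local Notation G := (G0 tl hd).

(** Dual form of connectivity: every nonempty cut meets [A]. *)
Definition spans A := [forall Z, uncut A Z ==> [forall e, cob Z e == 0]].
(* Independence in the cycle matroid: each edge of [A] is separated from the others by a cut. *)
Definition indep A := [forall f in A, exists Z, uncut (A :\ f) Z && (cob Z f != 0)].

Lemma spansP A : reflect (forall Z, uncut A Z -> forall e, cob Z e = 0) (spans A).
Proof.
apply: (iffP forallP) => H Z; last by apply/implyP=> /H HZ; apply/forallP=> e; rewrite HZ.
by move=> uZ e; have /implyP/(_ uZ)/forallP/(_ e)/eqP := H Z.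
Qed.

Lemma indepP A : reflect
  (forall f, f \in A -> exists2 Z, uncut (A :\ f) Z & cob Z f != 0) (indep A).
Proof.
apply: (iffP forall_inP) => H f /H.
  by case/existsP=> Z /andP[]; exists Z.
by case=> Z uZ Zf; apply/existsP; exists Z; rewrite uZ.
Qed.

(** The difference of the two coboundaries is the sum of those of [X] and [~: Y], hence of their
    union and intersection, and both of these avoid [B]. *)
Lemma spans_cob_eq B X Y : spans B -> (forall e, e \in B -> cob X e = cob Y e) ->
  forall e, cob X e = cob Y e.
Proof.
move=> /spansP sB XY e; have [|uU uI] := @uncutUI _ _ tl hd B X (~: Y).
  by move=> f /XY; rewrite cobC => ->; rewrite subrr.
have := cobUI tl hd X (~: Y) e; rewrite (sB _ uU) (sB _ uI) cobC; lia.
Qed.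

(** [Z] isolates the new edge [g]. A cut isolating another edge, if it cuts [g], is corrected by [Z]
    or its complement so that the sum vanishes at [g]; one of the two level sets still cuts that
    edge. *)
Lemma indep_exchange B f g Z : indep B -> f \in B ->
  uncut (B :\ f) Z -> cob Z f != 0 -> cob Z g != 0 -> indep (g |: B :\ f).
Proof.
move=> /indepP iB fB uZ Zf Zg; apply/indepP=> e; have [-> _|ne_eg] := eqVneq e g.
  exists Z => //; apply/uncutP=> h; rewrite !inE => /andP[/negbTE->] /= hB.
  by apply: (uncutP _ _ _ _ uZ); rewrite !inE.
rewrite !inE (negbTE ne_eg) /= => /andP[ne_ef eB].
have Ze : cob Z e = 0 by apply: (uncutP _ _ _ _ uZ); rewrite !inE ne_ef.
have [Y uY Ye] := iB e eB.
have [Yg|Yg] := eqVneq (cob Y g) 0.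
  exists Y => //; apply/uncutP=> h; rewrite !inE => /andP[he /orP[/eqP->//|/andP[_ hB]]].
  by apply: (uncutP _ _ _ _ uY); rewrite !inE he.
have [Z' [uZ' Z'e Z'g]] : exists Z',
    [/\ uncut (B :\ f) Z', cob Z' e = 0 & (cob Y g + cob Z' g = 0)%R].
  have bY := cob_bound tl hd Y g; have bZ := cob_bound tl hd Z g.
  have [YZ|YZ] := eqVneq (cob Y g + cob Z g)%R 0; first by exists Z.
  exists (~: Z); rewrite !cobC Ze; split; last lia; last by rewrite oppr0.
  by apply/uncutP=> h hB; rewrite cobC (uncutP _ _ _ _ uZ) ?oppr0.
have [|uU uI] := @uncutUI _ _ tl hd ((g |: B :\ f) :\ e) Y Z'.
  move=> h; rewrite !inE => /andP[he /orP[/eqP->//|/andP[hf hB]]].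
  by rewrite (uncutP _ _ _ _ uY) ?(uncutP _ _ _ _ uZ') // !inE ?he ?hf.
have := cobUI tl hd Y Z' e; rewrite Z'e => sum_e.
have [Ue|Ue] := eqVneq (cob (Y :|: Z') e) 0; last by exists (Y :|: Z').
by exists (Y :&: Z') => //; lia.
Qed.

Hypothesis conG : connected G.

Lemma connected_spans T : connected_by G T -> spans T.
Proof.
move=> cT; apply/spansP=> Z uZ e; rewrite /coboundary.
by rewrite (@connect_uncut _ _ G T Z _ (hd e)) ?subrr //; apply: cT; rewrite inE.
Qed.

Lemma spans_connected T : spans T -> connected_by G T.
Proof.
move=> /spansP sT x y _ _.
have /sT uT := uncut_connect G T x.
have := @connect_uncut _ _ G [set: 'I_m] [set y | connect (adj G T) x y] x y.
rewrite !inE connect0 => <- //; last by apply: conG; rewrite inE.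
by apply/uncutP=> e _; apply: uT.
Qed.

(** The cut isolating [f] is the component of its head in [T :\ f]. Conversely, a cycle inside [T]
    would meet an isolating cut in a single edge. *)
Lemma spanning_treeP T : spanning_tree G T <-> spans T && indep T.
Proof.
split=> [[_ cT aT]|/andP[sT /indepP iT]].
  rewrite connected_spans //=; apply/indepP=> f fT.
  have uZ := uncut_connect G (T :\ f) (hd f).
  exists [set y | connect (adj G (T :\ f)) (hd f) y] => //.
  rewrite /coboundary !inE connect0; case: (boolP (connect _ _ _)) => //= cf.
  have [||//|C [cC _ sC]] := @undirected_cycle _ _ G (T :\ f) f; rewrite ?inE ?eqxx ?subsetT //.
  by case: (aT (supp C)); [exists C|rewrite setD1K in sC].
split; [by rewrite subsetT | exact: spans_connected |] => D [C [cC <-]] sC.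
case: (cC) => x [s [[s0 _ _ _ _] [sCs _ _]]].
have [f fC] : exists f, f \in supp C.
  by case: s s0 sCs => // -[f y] s _ ->; exists f; rewrite !inE eqxx.
have [Z uZ Zf] := iT f (subsetP sC _ fC).
have [g [gC gf Zg]] := cycle_cut_orthogonal_neq cC fC Zf.
by move: Zg; rewrite (uncutP _ _ _ _ uZ) ?eqxx // !inE gf (subsetP sC).
Qed.

(** A spanning set of least size is independent: once [f] is removed, some cut avoids the rest, and
    it must contain [f]. *)
Lemma spanning_tree_exists : exists T, spanning_tree G T.
Proof.
have sT : spans setT by apply/spansP=> Z /uncutP uZ e; apply: uZ; rewrite inE.
case: (arg_minnP (fun A => #|A|) sT) => A sA Amin; exists A; apply/spanning_treeP.
rewrite sA; apply/indepP=> f fA.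
have : ~~ spans (A :\ f) by apply/negP=> /Amin; rewrite [in X in (X <= _)%N](cardsD1 f A) fA ltnn.
rewrite negb_forall => /existsP[Z]; rewrite negb_imply => /andP[uZ /forallPn[e Ze]].
exists Z => //; apply: contraNneq Ze => Zf; apply/eqP; apply: (spansP _ sA).
apply/uncutP=> h hA; have [->//|hf] := eqVneq h f.
by apply: (uncutP _ _ _ _ uZ); rewrite !inE hf.
Qed.

Lemma lexmin_spanning_tree_exists : exists T, lexmin_spanning_tree G T.
Proof.
have [T /spanning_treeP treeT] := spanning_tree_exists.
have [A tA Amin] := @extremumP _ _ (fun s t => lex_le s t) T
  (fun T => spans T && indep T) (@sorted_edges m) lex_le_refl lex_le_trans lex_le_total treeT.
by exists A; split; [apply/spanning_treeP | move=> B /spanning_treeP/Amin].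
Qed.

Lemma mem_sorted_edges A e : ((e : nat) \in sorted_edges A) = (e \in A).
Proof. by rewrite mem_sort mem_map ?mem_enum //; apply: val_inj. Qed.

Lemma sorted_sorted_edges A : sorted ltn (sorted_edges A).
Proof.
rewrite ltn_sorted_uniq_leq sort_uniq map_inj_uniq ?enum_uniq /=; last exact: val_inj.
exact: (sort_sorted leq_total).
Qed.

Lemma lex_le_exchange A f g : (g < f)%N -> g \notin A -> f \in A ->
  ~~ lex_le (sorted_edges A) (sorted_edges (g |: A :\ f)).
Proof.
move=> gf gA fA; apply: (@lex_le_first_diff _ _ g); rewrite ?sorted_sorted_edges //.
- by rewrite mem_sorted_edges !inE eqxx.
- by rewrite mem_sorted_edges.
- move=> z; rewrite inE /= => zg; pose z' : 'I_m := Ordinal (ltn_trans zg (ltn_ord g)).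
  have := mem_sorted_edges A z'; have := mem_sorted_edges (g |: A :\ f) z'.
  move=> /= -> ->; rewrite !inE -!val_eqE /= (ltn_eqF zg) (ltn_eqF (ltn_trans zg gf)) //.
- by apply/hasP; exists (f : nat) => //; rewrite mem_sorted_edges.
Qed.

(* With independence: [F] is the lexicographically smallest spanning tree of the contraction by [K]. *)
Definition greedy K F := forall X e, uncut K X -> cob X e != 0 ->
  (forall g, (g < e)%N -> cob X g = 0) -> e \in F.

Lemma greedy_spans K F : greedy K F -> spans (K :|: F).
Proof.
move=> gF; apply/spansP=> Z uZ e; apply/eqP/negPn/negP=> /first_cut[f Zf fmin].
have fF : f \in F.
  by apply: (gF Z f) => //; apply/uncutP=> h hK; apply: (uncutP _ _ _ _ uZ); rewrite inE hK.
by move: Zf; rewrite (uncutP _ _ _ _ uZ) ?eqxx // inE fF orbT.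
Qed.

(** If the least edge [e] of a cut were outside [T], its fundamental cycle would meet the cut in a
    larger edge [g] of [T], and exchanging [g] for [e] would give a smaller tree. *)
Lemma lexmin_greedy T : lexmin_spanning_tree G T -> greedy set0 T.
Proof.
case=> /spanning_treeP/andP[sT iT] Tmin X e _ Xe emin; apply/negPn/negP=> eT.
have [||C [cC eC sC]] := @undirected_cycle _ _ G T e eT; rewrite ?subsetT //.
  by apply: (spans_connected sT); rewrite inE.
have [g [gC ge Xg]] := cycle_cut_orthogonal_neq cC eC Xe.
have inT f : f \in supp C -> f != e -> f \in T.
  by move=> /(subsetP sC); rewrite inE => /orP[/set1P->|//]; rewrite eqxx.
have gT := inT g gC ge.
have lt_eg : (e < g)%N.
  rewrite ltnNge; apply: contra Xg => le_ge; apply/eqP/emin.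
  by rewrite ltn_neqAle le_ge andbT val_eqE.
(* A cut isolating [g] in [T] meets the fundamental cycle a second time, which can only be at
   [e]. *)
have cutC Z : uncut (T :\ g) Z -> cob Z g != 0 -> cob Z e != 0.
  move=> uZ Zg; have [f [fC fg Zf]] := cycle_cut_orthogonal_neq cC gC Zg.
  have [<-//|fe] := eqVneq f e.
  have {}Zf : cob Z f != 0 := Zf.
  by move: Zf; rewrite (uncutP _ _ _ _ uZ) ?eqxx // !inE fg (inT _ fC fe).
have := lex_le_exchange lt_eg eT gT; rewrite Tmin //; apply/spanning_treeP/andP; split; last first.
  by have [Z uZ Zg] := indepP _ iT _ gT; apply: (indep_exchange iT gT uZ Zg); apply: cutC.
apply/spansP=> Z uZ; apply: (spansP _ sT); apply/uncutP=> h hT.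
have [->|hg] := eqVneq h g; last by apply: (uncutP _ _ _ _ uZ); rewrite !inE hg hT orbT.
have uT : uncut (T :\ g) Z.
  by apply/uncutP=> f fT; apply: (uncutP _ _ _ _ uZ); rewrite inE fT orbT.
apply/eqP/negPn/negP=> /(cutC Z uT).
by rewrite (uncutP _ _ _ _ uZ) ?eqxx // !inE eqxx.
Qed.

Lemma T0_lexmin : lexmin_spanning_tree G (T0 tl hd).
Proof. exact: epsilon_spec lexmin_spanning_tree_exists. Qed.

End Trees.

(** * The optimal cocycle *)

Section OptimalCocycle.
Variables (V : finType) (m : nat) (tl hd : 'I_m -> V).
Implicit Types (A B D K E F S T : {set 'I_m}) (X Y Z W : {set V}).
Implicit Types (e f g p q : 'I_m) (C : sset m).

Local Notation cob := (coboundary tl hd).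
Local Notation uncut := (uncut tl hd).
Local Notation nonneg := (nonneg tl hd).
Local Notation greedy := (greedy tl hd).
Local Notation G := (G0 tl hd).
Local Notation cls := (cls tl hd).
Local Notation minor := (minor tl hd).

(** Induction on a threshold [k]: among the elements that agree with the previous choice on the
    edges of [F] below [k], one with the largest value at [k] is taken. *)
Lemma lexmax_exists (T : finType) (P : pred T) (d : T -> 'I_m -> int) F :
  (exists x, P x) ->
  exists2 x, P x & forall y f, P y -> f \in F ->
    (forall g, g \in F -> (g < f)%N -> d y g = d x g) -> (d y f <= d x f)%R.
Proof.
move=> exP.
suff /(_ m)[x Px xmax] : forall k, exists2 x, P x & forall y f, P y -> f \in F -> (f < k)%N ->
    (forall g, g \in F -> (g < f)%N -> d y g = d x g) -> (d y f <= d x f)%R.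
  by exists x => // y f Py fF; apply: xmax.
elim=> [|k [x Px xmax]]; first by case: exP => x Px; exists x.
have [k_lt|k_ge] := ltnP k m; last first.
  by exists x => // y f Py fF fk; apply: xmax => //; have := ltn_ord f; lia.
pose k' := Ordinal k_lt.
pose Q y := P y && [forall g in F, (g < k)%N ==> (d y g == d x g)].
have Qx : Q x by rewrite /Q Px; apply/forall_inP=> g _; rewrite eqxx implybT.
have [z /andP[Pz /forall_inP zx] zmax] :=
  @extremumP _ _ (fun a b : int => (b <= a)%R) x Q (fun y => d y k') (@lexx _ _)
   (fun a b c ba ac => le_trans ac ba) (fun a b => le_total b a) Qx.
have {}zx g : g \in F -> (g < k)%N -> d z g = d x g.
  by move=> gF gk; have := zx g gF; rewrite gk => /eqP.
exists z => // y f Py fF; rewrite ltnS leq_eqVlt => /orP[/eqP fk|fk] yz; last first.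
  rewrite zx //; apply: xmax => // g gF gf; rewrite yz // zx //; exact: ltn_trans gf fk.
have -> : f = k' by apply: val_inj.
apply: zmax; rewrite /Q Py; apply/forall_inP=> g gF; apply/implyP=> gk.
by rewrite yz ?fk // zx.
Qed.

(** * Cuts of a minor as cuts of the original graph *)

Section Minors.
Variables (K S : {set 'I_m}).

Lemma cls_mem X v : uncut K X -> (cls K v \in X) = (v \in X).
Proof.
move=> uX; symmetry; apply: (@connect_uncut _ _ G K X v) => //; exact: connect_root.
Qed.

Lemma cls_edge e : e \in K -> cls K (tl e) = cls K (hd e).
Proof.
move=> eK; apply/eqP; rewrite (root_connect (sym_connect_sym (@adj_sym _ _ G K))).
apply/connect1/existsP.
by exists e; rewrite eK !eqxx.
Qed.

Lemma cob_cls X e : uncut K X -> coboundary (tailv (minor K S)) (headv (minor K S)) X e = cob X e.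
Proof. by move=> uX; rewrite /coboundary /= !cls_mem. Qed.

Lemma uncut_cls X : uncut K [set v | cls K v \in X].
Proof. by apply/uncutP=> e eK; rewrite /coboundary !inE cls_edge // subrr. Qed.

Definition signs X : sset m := ([set e in S | cob X e == 1%R], [set e in S | cob X e == - 1%R]%R).
Definition minor_cut X := [set e in S | cob X e != 0].

(** A shore in the minor consists of class representatives; its preimage under [cls K] has the same
    cut. *)
Lemma is_cut_minor D : is_cut (minor K S) D -> exists2 X, uncut K X & D = minor_cut X.
Proof.
case=> X [_ ->]; exists [set v | cls K v \in X]; first exact: uncut_cls.
by apply/setP=> e; rewrite !inE /coboundary !inE /=; do 2! case: (_ \in X).
Qed.

Lemma signed_cocycle_minor C : signed_cocycle (minor K S) C ->
  exists2 X, uncut K X & C = signs X.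
Proof.
case=> X [_ _ ->]; exists [set v | cls K v \in X]; first exact: uncut_cls.
by congr (_, _); apply/setP=> e; rewrite !inE /coboundary !inE /=; do 2! case: (_ \in X).
Qed.

Lemma minor_signed_cocycle X : uncut K X -> minor_cut X != set0 ->
  (forall W, uncut K W -> minor_cut W != set0 -> minor_cut W \subset minor_cut X ->
     minor_cut W = minor_cut X) ->
  signed_cocycle (minor K S) (signs X).
Proof.
(* Back to the minor: only the class representatives in [X] are kept. *)
move=> uX X0 Xmin; pose X' := X :&: vset (minor K S).
have mem_cls v : (cls K v \in X') = (v \in X) by rewrite inE cls_mem // imset_f ?andbT.
have sX' : X' \subset vset (minor K S) by rewrite subsetIr.
have cutX' : cut (minor K S) X' = minor_cut X.
  by apply/setP=> e; rewrite [LHS]inE [RHS]inE /= !mem_cls /coboundary; do 2! case: (_ \in X).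
exists X'; split=> //.
  rewrite cutX'; split=> //; first by exists X'; rewrite cutX'.
  by move=> _ /is_cut_minor[W uW ->]; apply: Xmin.
by congr (_, _); apply/setP=> e; rewrite [LHS]inE [RHS]inE /= !mem_cls /coboundary;
  do 2! case: (_ \in X).
Qed.

Lemma supp_signs X : supp (signs X) = minor_cut X.
Proof. by apply/setP=> e; rewrite !inE /coboundary; do 2! case: (_ \in X); case: (_ \in S). Qed.

End Minors.

Definition cand K p E X := [&& uncut K X, nonneg E X & cob X p == 1%R].

(* The maximum is over all admissible cuts, not only cocycles; under the invariants it is
   nevertheless a cocycle ([lexmax_signed_cocycle]), hence the optimal cocycle. *)
Definition lexmax K p E F Y := cand K p E Y /\
  forall X f, cand K p E X -> f \in F ->
    (forall g, g \in F -> (g < f)%N -> cob X g = cob Y g) -> (cob X f <= cob Y f)%R.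

(** Instantiated with [p |: K]. The least edge is taken among all edges of the original graph,
    deleted ones included. *)
Definition neg_first K E := forall Z e, uncut K Z -> nonneg E Z -> cob Z e != 0 ->
  (forall g, (g < e)%N -> cob Z g = 0) -> (cob Z e < 0)%R.

(** * The lexicographic maximum is the optimal cocycle *)

Section Optimal.
Variables (K : {set 'I_m}) (p : 'I_m) (E F : {set 'I_m}).
Hypothesis pE : p \in E.
Hypothesis greedyF : greedy (p |: K) F.
Hypothesis negE : neg_first (p |: K) E.

Lemma uncutU1 X : cob X p = 0 -> uncut K X -> uncut (p |: K) X.
Proof. by move=> Xp /uncutP uX; apply/uncutP=> e /setU1P[->|/uX]. Qed.

(* Otherwise [Y1] would beat [Y]: the first edge cut by [Z] is negative and lies in [F]. *)
Lemma lexmax_split Y Y1 Z : lexmax K p E F Y -> uncut K Y1 -> nonneg E Y1 ->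
  uncut K Z -> nonneg E Z -> cob Z p = 0 ->
  (forall e, cob Y1 e + cob Z e = cob Y e)%R -> forall e, cob Z e = 0.
Proof.
move=> [/and3P[_ _ /eqP Yp] Ymax] uY1 nY1 uZ nZ Zp sumY e.
apply/eqP/negPn/negP=> /first_cut[f Zf fmin].
have uZ' := uncutU1 Zp uZ.
have Zf0 := negE uZ' nZ Zf fmin.
have fF := greedyF uZ' Zf fmin.
have cY1 : cand K p E Y1 by rewrite /cand uY1 nY1; have := sumY p; lia.
have := Ymax Y1 f cY1 fF; have := sumY f.
suff H : forall g, g \in F -> (g < f)%N -> cob Y1 g = cob Y g by move=> ? /(_ H); lia.
by move=> g _ gf; have := sumY g; rewrite fmin // addr0.
Qed.

(** For a cut of [W] inside that of [Y], the coboundary of [Y] is the sum of those of [Y :&: W] and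
    [Y :\: W], and also of those of [Y :|: W] and [Y :|: ~: W]. All four are nonnegative on [E], and
    in each pair [lexmax_split] annihilates the one that avoids [p]. *)
Lemma lexmax_signed_cocycle Y : lexmax K p E F Y ->
  signed_cocycle (minor K (E :|: F)) (signs (E :|: F) Y).
Proof.
move=> lY; case: (lY) => /and3P[uY nY /eqP Yp] _.
apply: minor_signed_cocycle => //.
  by apply/set0Pn; exists p; rewrite !inE pE Yp.
move=> W; wlog pW : W / tl p \in W => [hwlog|].
  have [|pW] := boolP (tl p \in W); first exact: hwlog.
  have <- : minor_cut (E :|: F) (~: W) = minor_cut (E :|: F) W.
    by apply/setP=> e; rewrite !inE cobC oppr_eq0.
  move=> uW; apply: hwlog; first by rewrite inE.
  by apply/uncutP=> e eK; rewrite cobC (uncutP _ _ _ _ uW) ?oppr0.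
move=> uW W0 sWY.
have WY e : e \in E :|: F -> (cob Y e == 0) ==> (cob W e == 0).
  move=> eS; apply/implyP; apply: contraTT => We.
  by have /(subsetP sWY) : e \in minor_cut (E :|: F) W; rewrite inE eS.
have KYW e : e \in K -> cob Y e == 0 /\ cob W e == 0.
  by move=> eK; rewrite (uncutP _ _ _ _ uY) // (uncutP _ _ _ _ uW).
have YWE e : e \in E -> ((cob Y e == 0) ==> (cob W e == 0)) /\ (0 <= cob Y e)%R.
  by move=> eE; split; [apply: WY; rewrite inE eE | apply: (nonnegP _ _ _ _ nY)].
have Z1 : forall e, cob (Y :\: W) e = 0.
  apply: (@lexmax_split Y (Y :&: W)) => //.
  - by apply/uncutP=> e /KYW[]; rewrite /coboundary !inE; do 4! case: (_ \in _).
  - by apply/nonnegP=> e /YWE[]; rewrite /coboundary !inE; do 4! case: (_ \in _).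
  - by apply/uncutP=> e /KYW[]; rewrite /coboundary !inE; do 4! case: (_ \in _).
  - by apply/nonnegP=> e /YWE[]; rewrite /coboundary !inE; do 4! case: (_ \in _).
  - by move: Yp; rewrite /coboundary !inE pW; do 3! case: (_ \in _).
  - by move=> e; rewrite /coboundary !inE; do 4! case: (_ \in _).
have [hpW|hpW] := boolP (hd p \in W).
  (* With both ends of [p] in [W], the second vanishing piece is [Y :|: W], which leaves no kept
     edge cut by [W]. *)
  have Z2 : forall e, cob (Y :|: W) e = 0.
    apply: (@lexmax_split Y (Y :|: ~: W)) => //.
    - by apply/uncutP=> e /KYW[]; rewrite /coboundary !inE; do 4! case: (_ \in _).
    - by apply/nonnegP=> e /YWE[]; rewrite /coboundary !inE; do 4! case: (_ \in _).
    - by apply/uncutP=> e /KYW[]; rewrite /coboundary !inE; do 4! case: (_ \in _).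
    - by apply/nonnegP=> e /YWE[]; rewrite /coboundary !inE; do 4! case: (_ \in _).
    - by move: Yp; rewrite /coboundary !inE pW hpW; do 2! case: (_ \in _).
    - by move=> e; rewrite /coboundary !inE; do 4! case: (_ \in _).
  case/set0Pn: W0 => e; rewrite inE => /andP[/WY]; move: (Z1 e) (Z2 e).
  by rewrite /coboundary !inE; do 4! case: (_ \in _).
(* Here [p] leaves [W] as it leaves [Y]; the vanishing pieces force the two cuts to coincide. *)
have Z2 : forall e, cob (Y :|: ~: W) e = 0.
  apply: (@lexmax_split Y (Y :|: W)) => //.
  - by apply/uncutP=> e /KYW[]; rewrite /coboundary !inE; do 4! case: (_ \in _).
  - by apply/nonnegP=> e /YWE[]; rewrite /coboundary !inE; do 4! case: (_ \in _).
  - by apply/uncutP=> e /KYW[]; rewrite /coboundary !inE; do 4! case: (_ \in _).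
  - by apply/nonnegP=> e /YWE[]; rewrite /coboundary !inE; do 4! case: (_ \in _).
  - by move: Yp; rewrite /coboundary !inE pW hpW; do 2! case: (_ \in _).
  - by move=> e; rewrite /coboundary !inE; do 4! case: (_ \in _).
apply/eqP; rewrite eqEsubset sWY; apply/subsetP=> e; rewrite !inE => /andP[-> /=].
by move: (Z1 e) (Z2 e); rewrite /coboundary !inE; do 4! case: (_ \in _).
Qed.

Lemma cand_admissible C : admissible (minor K (E :|: F)) p E C ->
  exists2 X, cand K p E X & C = signs (E :|: F) X.
Proof.
case=> /signed_cocycle_minor[X uX ->] pX dX; exists X => //.
rewrite /cand uX; move: pX; rewrite inE => /andP[_ ->]; rewrite andbT.
apply/nonnegP=> e eE; have := disjointFl dX eE; rewrite !inE eE /=.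
have := cob_bound tl hd X e; lia.
Qed.

(** Candidates that agree on [F] also agree on [p] and [K], hence everywhere because these edges
    span; so a different competitor differs on [F], where the first difference decides. *)
Lemma lexmax_optimal Y : lexmax K p E F Y ->
  is_optimal_cocycle (minor K (E :|: F)) p E F (signs (E :|: F) Y).
Proof.
move=> lY; case: (lY) => cY Ymax; case/and3P: (cY) => uY nY /eqP Yp; split.
  split; [exact: lexmax_signed_cocycle | by rewrite !inE pE Yp |].
  rewrite -setI_eq0; apply/eqP/setP=> e; rewrite !inE; apply/negP=> /andP[/andP[_ Ye] eE].
  by have := nonnegP _ _ _ _ nY e eE; rewrite (eqP Ye).
move=> D /cand_admissible[X cX ->] neXY; case/and3P: (cX) => uX nX /eqP Xp.
have [f fF Xf] : exists2 f, f \in F & cob X f != cob Y f.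
  apply: NNPP => Hno; apply: neXY.
  have XY : forall e, cob X e = cob Y e.
    apply: (spans_cob_eq (greedy_spans greedyF)) => e; rewrite !inE => /orP[/orP[/eqP->|eK]|eF].
    - by rewrite Xp Yp.
    - by rewrite (uncutP _ _ _ _ uX) // (uncutP _ _ _ _ uY).
    - by apply/eqP/negPn/negP=> Xe; apply: Hno; exists e.
  by congr (_, _); apply/setP=> e; rewrite !inE XY.
have fP : (f \in F) && (cob X f != cob Y f) by rewrite fF Xf.
case: (@arg_minnP _ f (fun f => (f \in F) && (cob X f != cob Y f)) (@nat_of_ord m) fP).
move=> {fP Xf}f0 /andP[f0F Xf] f0min.
have f0_below g : g \in F -> (g < f0)%N -> cob X g = cob Y g.
  by move=> gF gf; apply/eqP/negPn/negP=> Xg; have := f0min g; rewrite gF Xg leqNgt gf => /(_ isT).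
have := Ymax X f0 cX f0F f0_below => XYf.
exists f0; split=> //.
- move: Xf; rewrite /differ !inE f0F orbT /coboundary.
  by case: (tl f0 \in Y); case: (hd f0 \in Y); case: (tl f0 \in X); case: (hd f0 \in X).
- move=> g gF gf; rewrite /differ !inE gF orbT /= f0_below //.
  by rewrite eqxx /= /coboundary; do 2! case: (_ \in Y).
- move: XYf Xf; rewrite !inE f0F orbT /coboundary.
  by case: (tl f0 \in Y); case: (hd f0 \in Y); case: (tl f0 \in X); case: (hd f0 \in X).
Qed.

(** Any other choice of the optimum would be greater than the cocycle of [Y] in [cocycle_gt],
    against the maximality of [Y]. *)
Lemma opt_cocycle_lexmax : (exists X, cand K p E X) ->
  exists2 Y, lexmax K p E F Y &
    opt_cocycle (minor K (E :|: F)) p E F = signs (E :|: F) Y.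
Proof.
move=> /(@lexmax_exists _ (cand K p E) cob F)[Y cY Ymax].
have lY : lexmax K p E F Y by [].
exists Y => //.
have [admY optY] := lexmax_optimal lY.
have : is_optimal_cocycle (minor K (E :|: F)) p E F (opt_cocycle (minor K (E :|: F)) p E F).
  by apply: epsilon_spec; exists (signs (E :|: F) Y); apply: lexmax_optimal.
set C := opt_cocycle _ _ _ _ => -[admC optC]; apply: NNPP => CY.
have [X cX CX] := cand_admissible admC.
have [f [fF fd f_below fC]] := optC _ admY (nesym CY).
have := Ymax X f cX fF.
suff -> : (cob X f <= cob Y f)%R = false.
  move=> /(_ _)/negP[] // g gF gf; have := f_below g gF gf.
  rewrite CX /differ !inE gF orbT /coboundary.
  by case: (tl g \in Y); case: (hd g \in Y); case: (tl g \in X); case: (hd g \in X).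
move: fd fC; rewrite CX /differ !inE fF orbT /coboundary.
by case: (tl f \in Y); case: (hd f \in Y); case: (tl f \in X); case: (hd f \in X).
Qed.

End Optimal.
End OptimalCocycle.

(** * One step of the algorithm *)

Section Step.
Variables (V : finType) (m : nat) (tl hd : 'I_m -> V).
Implicit Types (A B D K E F S T : {set 'I_m}) (X Y Z W : {set V}).
Implicit Types (e f g p q : 'I_m) (C : sset m).

Local Notation cob := (coboundary tl hd).
Local Notation uncut := (uncut tl hd).
Local Notation nonneg := (nonneg tl hd).
Local Notation greedy := (greedy tl hd).
Local Notation indep := (indep tl hd).
Local Notation cls := (cls tl hd).
Local Notation minor := (minor tl hd).
Local Notation lexmax := (lexmax tl hd).
Local Notation cand := (cand tl hd).
Local Notation neg_first := (neg_first tl hd).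

Lemma sminP A d : A != set0 -> smin A d \in A /\ forall e, e \in A -> (smin A d <= e)%N.
Proof.
case/set0Pn=> x xA; rewrite /smin; case: pickP => [y /andP[yA /forall_inP ymin]|] //=.
case: (@arg_minnP _ x (fun x => x \in A) (@nat_of_ord m) xA) => y yA ymin /(_ y).
by rewrite yA /= => /negP[]; apply/forall_inP=> e /ymin.
Qed.

Lemma smaxP A d : A != set0 -> smax A d \in A /\ forall e, e \in A -> (e <= smax A d)%N.
Proof.
case/set0Pn=> x xA; rewrite /smax; case: pickP => [y /andP[yA /forall_inP ymax]|] //=.
case: (@arg_maxnP _ x (fun x => x \in A) (@nat_of_ord m) xA) => y yA ymax /(_ y).
by rewrite yA /= => /negP[]; apply/forall_inP=> e /ymax.
Qed.

(** A fundamental cycle exists: otherwise the vertices reached from the head of [q] through [F] and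
    [p] would define a nonempty cut avoiding the spanning set [p |: K :|: F]. *)
Lemma fund_cycleP K p E F q : p \in E -> greedy (p |: K) F -> q \in E -> q \notin p |: F ->
  let D := fund_cycle (minor K (E :|: F)) (F :|: [set p]) q in
  [/\ D != set0, D \subset F :|: [set p] :|: [set q] &
    forall X e, uncut K X -> e \in D -> cob X e != 0 ->
      exists g, [/\ g \in D, g != e & cob X g != 0]].
Proof.
move=> pE gF qE qF; set M := minor K (E :|: F).
have [C [cC qC sC]] : exists C,
    [/\ signed_cycle M C, q \in supp C & supp C \subset q |: (F :|: [set p])].
  apply: undirected_cycle; first by rewrite setUC.
    apply/subsetP=> e; rewrite !inE => /orP[/eqP->|/orP[->|/eqP->]]; rewrite ?qE ?pE ?orbT //.
  rewrite /=; have uZ0 := uncut_connect M (F :|: [set p]) (cls K (hd q)).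
  set Z0 := [set y | _] in uZ0.
  have uZ : uncut (p |: K :|: F) [set v | cls K v \in Z0].
    apply/uncutP=> e; rewrite 2!inE -orbA orbCA => /orP[eK|eF].
      by apply: (uncutP _ _ _ _ (uncut_cls _ _ _ _)).
    have : e \in F :|: [set p] by rewrite inE orbC.
    by move/(uncutP _ _ _ _ uZ0); rewrite /coboundary ![_ \in [set v | cls K v \in Z0]]inE.
  have /eqP := spansP _ _ _ (greedy_spans gF) _ uZ q.
  rewrite /coboundary !inE connect0; by case: (connect _ _ _).
have exD : exists D, Defs.cycle M D /\ D \subset F :|: [set p] :|: [set q].
  by exists (supp C); split; [exists C | rewrite setUC].
have := epsilon_spec (inhabits set0) _ exD; rewrite -/(fund_cycle M (F :|: [set p]) q).
set D := fund_cycle _ _ _; case=> -[C' [cC' <-]] sC'; split=> //.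
  case: (cC') => x [s [[s0 _ _ _ _] [sCs _ _]]]; apply/set0Pn.
  by case: s s0 sCs => // -[f y] s _ ->; exists f; rewrite !inE eqxx.
move=> X e uX eC Xe; rewrite -(cob_cls (E :|: F) e uX) in Xe.
have [g [gC ge Xg]] := cycle_cut_orthogonal_neq cC' eC Xe.
by exists g; rewrite -(cob_cls (E :|: F) g uX).
Qed.

(** Invariant with [n] steps left, [K] contracted and [p] about to be. [state_sep] expresses
    acyclicity of the ground set: each of its edges lies in a directed cut. *)
Record state n K p E F : Prop := State {
  state_mem : p \in E;
  state_min : forall e, e \in E -> (p <= e)%N;
  state_card : #|F| = n;
  state_disj : [disjoint F & p |: K];
  state_indep : indep (p |: K :|: F);
  state_greedy : greedy (p |: K) F;
  state_sep : forall e, e \in E -> exists X, [/\ uncut K X, nonneg E X & cob X e = 1%R];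
  state_neg : neg_first (p |: K) E }.

Definition flat E Y := [set e in E | cob Y e == 0].

Lemma neg_first_flat K p E F Y : p \in E -> greedy (p |: K) F -> neg_first (p |: K) E ->
  lexmax K p E F Y -> neg_first (p |: K) (flat E Y).
Proof.
move=> pE gF negE [/and3P[uY nY /eqP Yp] Ymax] Z e uZ nZ Ze emin.
have uKZ : uncut K Z by apply/uncutP=> f fK; apply: (uncutP _ _ _ _ uZ); rewrite inE fK orbT.
have Zp : cob Z p = 0 by apply: (uncutP _ _ _ _ uZ); rewrite setU11.
rewrite ltNge; apply/negP=> Ze0.
have eF := gF _ _ uZ Ze emin.
(* Where [Y] does not vanish on [E] it equals 1, which compensates a negative value of [Z]. *)
have sum0 f : f \in E -> (0 <= cob Y f + cob Z f)%R.
  move=> fE; have := nonnegP _ _ _ _ nY f fE; have [Yf _|Yf Yf0] := eqVneq (cob Y f) 0.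
    by rewrite Yf add0r; apply: (nonnegP _ _ _ _ nZ); rewrite inE fE Yf eqxx.
  have Y1 : (1 <= cob Y f)%R by rewrite -gtz0_ge1 lt_neqAle eq_sym Yf.
  by have := cob_bound tl hd Z f; rewrite -(subrr 1%R) => /andP[Z1 _]; apply: lerD.
have [|uU uI] := @uncutUI _ _ tl hd K Y Z.
  by move=> f fK; rewrite (uncutP _ _ _ _ uY) ?(uncutP _ _ _ _ uKZ).
have nU : nonneg E (Y :|: Z) by apply/nonnegP=> f /sum0/cob_sum_ge0/andP[].
have nI : nonneg E (Y :&: Z) by apply/nonnegP=> f /sum0/cob_sum_ge0/andP[].
(* The sum is 1 at [p], so exactly one level set is cut by [p]: it is the competitor [Y1], and [W]
   is the other one. *)
have [Y1 [W [cY1 uW nW Wp sumW]]] : exists Y1 W, [/\ cand K p E Y1, uncut (p |: K) W, nonneg E W,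
    cob W p = 0 & forall f, (cob Y1 f + cob W f = cob Y f + cob Z f)%R].
  have [[Up Ip]|[Up Ip]] : (cob (Y :|: Z) p = 1%R /\ cob (Y :&: Z) p = 0) \/
      (cob (Y :|: Z) p = 0 /\ cob (Y :&: Z) p = 1%R).
    by move: Yp Zp; rewrite /coboundary !inE; (do 4! case: (_ \in _)) => //= _ _; by [left|right].
  - exists (Y :|: Z), (Y :&: Z); split=> // [||f]; last exact: cobUI.
      by rewrite /cand uU nU Up.
    exact: uncutU1.
  - exists (Y :&: Z), (Y :|: Z); split=> // [||f]; last by rewrite addrC cobUI.
      by rewrite /cand uI nI Ip.
    exact: uncutU1.
(* [Y1] exceeds [Y] by the difference of [Z] and [W], so it wins where [W] first falls below [Z]. *)
have beat f : f \in F -> (forall g, (g < f)%N -> cob W g = 0 /\ cob Z g = 0) ->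
    (cob W f < cob Z f)%R -> False.
  move=> fF below WZ; have := Ymax Y1 f cY1 fF.
  suff H : forall g, g \in F -> (g < f)%N -> cob Y1 g = cob Y g.
    by move=> /(_ H); rewrite leNgt -(ltrD2r (cob W f)) sumW ltrD2l WZ.
  by move=> g _ /below[Wg Zg]; have := sumW g; rewrite Wg Zg !addr0.
(* If [W] vanishes before [e], it is zero or negative at [e], where [Z] is positive. Otherwise its
   least edge precedes [e], lies in [F] and is negative, while [Z] vanishes there. *)
have [/forallP H|] := boolP [forall g : 'I_m, (g < e)%N ==> (cob W g == 0)].
  have Wbelow g : (g < e)%N -> cob W g = 0 by move=> ge; apply/eqP; apply: (implyP (H g)).
  apply: (beat e eF) => [g ge|]; first by rewrite Wbelow ?emin.
  have [We|We] := eqVneq (cob W e) 0; first by rewrite We lt_neqAle eq_sym Ze.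
  exact: lt_le_trans (negE W e uW nW We Wbelow) Ze0.
case/forallPn=> g; rewrite negb_imply => /andP[ge Wg].
have [w Ww wmin] := first_cut Wg.
have wg : (w <= g)%N by rewrite leqNgt; apply/negP=> /wmin gw; rewrite gw eqxx in Wg.
apply: (beat w (gF _ _ uW Ww wmin)) => [h hw|].
  by rewrite wmin ?emin // (ltn_trans hw) // (leq_ltn_trans wg).
by rewrite (emin w) ?(leq_ltn_trans wg ge) //; apply: (negE W).
Qed.

Lemma sep_flat K p E Y : p \in E -> uncut K Y -> nonneg E Y -> cob Y p = 1%R ->
  (forall e, e \in E -> exists X, [/\ uncut K X, nonneg E X & cob X e = 1%R]) ->
  forall e, e \in flat E Y -> exists X, [/\ uncut (p |: K) X, nonneg (flat E Y) X & cob X e = 1%R].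
Proof.
move=> pE uY nY Yp sepE e; rewrite inE => /andP[eE /eqP Ye].
have [X [uX nX Xe]] := sepE e eE.
have [Xp|Xp] := eqVneq (cob X p) 0.
  exists X; split=> //; first exact: uncutU1.
  by apply/nonnegP=> f; rewrite inE => /andP[fE _]; apply: (nonnegP _ _ _ _ nX).
have {}Xp : cob X p = 1%R.
  by have := cob_bound tl hd X p; have := nonnegP _ _ _ _ nX p pE; lia.
have [|uU uI] := @uncutUI _ _ tl hd (p |: K) X (~: Y).
  move=> f; rewrite cobC => /setU1P[->|fK]; first by rewrite Xp Yp.
  by rewrite (uncutP _ _ _ _ uX) ?(uncutP _ _ _ _ uY).
have sum0 f : f \in flat E Y -> (0 <= cob X f + cob (~: Y) f)%R.
  by rewrite inE cobC => /andP[fE /eqP->]; rewrite subr0; apply: (nonnegP _ _ _ _ nX).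
have nU : nonneg (flat E Y) (X :|: ~: Y) by apply/nonnegP=> f /sum0/cob_sum_ge0/andP[].
have nI : nonneg (flat E Y) (X :&: ~: Y) by apply/nonnegP=> f /sum0/cob_sum_ge0/andP[].
have [Ue|Ie] : cob (X :|: ~: Y) e = 1%R \/ cob (X :&: ~: Y) e = 1%R.
  by move: Xe Ye; rewrite /coboundary !inE; (do 4! case: (_ \in _)) => //= _ _; by [left|right].
- by exists (X :|: ~: Y).
- by exists (X :&: ~: Y).
Qed.

(** The clause [neg_first (p |: K) E'] is stated apart from the new state because it also covers
    cuts through [q], in particular the fundamental cut of [q]. *)
Lemma run_step n K p E F : state n.+1 K p E F ->
  let M := minor K (E :|: F) in
  let E' := E :\: supp (opt_cocycle M p E F) in
  let q := smin E' p in
  let F' := if q \in F then F :\ q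
            else F :\ smax (F :&: fund_cycle M (F :|: [set p]) q) q in
  exists Y, [/\ uncut K Y, nonneg E Y, cob Y p = 1%R & E' = flat E Y]
    /\ neg_first (p |: K) E' /\ state n (p |: K) q E' F'.
Proof.
move=> [pE pmin cF dF iF gF sepE negE] M E' q F'.
have [Y lY optY] : exists2 Y, lexmax K p E F Y & opt_cocycle M p E F = signs tl hd (E :|: F) Y.
  apply: opt_cocycle_lexmax => //; have [X [uX nX Xp]] := sepE p pE.
  by exists X; rewrite /cand uX nX Xp.
have [/and3P[uY nY /eqP Yp] _] := lY.
have defE' : E' = flat E Y.
  rewrite /E' optY supp_signs; apply/setP=> e; rewrite !inE.
  by case: (e \in E); rewrite ?andbF //= andbT negbK.
have negE' : neg_first (p |: K) E' by rewrite defE'; apply: (neg_first_flat pE gF).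
exists Y; split=> //; split=> //.
(* With an empty ground set, a cut isolating an edge of [F] and its complement would both have a
   negative least edge. *)
have E'0 : E' != set0.
  apply/eqP=> E'0.
  have [f fF] : exists f, f \in F by apply/set0Pn; rewrite -card_gt0 cF.
  have [|Z uZ Zf] := indepP _ _ _ iF f; first by rewrite inE fF orbT.
  have uKZ : uncut (p |: K) Z.
    apply/uncutP=> e eK; apply: (uncutP _ _ _ _ uZ); rewrite in_setD1 inE eK orTb andbT.
    by apply: contraTneq fF => <-; rewrite (disjointFl dF eK).
  have [e Ze emin] := first_cut Zf.
  have nE' X : nonneg E' X by rewrite E'0; apply/nonnegP=> g; rewrite inE.
  have Ze0 := negE' Z e uKZ (nE' Z) Ze emin.
  have : (cob (~: Z) e < 0)%R.
    apply: negE' => [||| g ge]; rewrite ?cobC ?oppr_eq0 // ?emin //.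
    by apply/uncutP=> g gK; rewrite cobC (uncutP _ _ _ _ uKZ).
  by rewrite cobC oppr_lt0 ltNge ltW.
have [qE' qmin] := sminP p E'0; rewrite -/q in qE' qmin.
have [qE Yq] : q \in E /\ cob Y q = 0 by move: qE'; rewrite defE' inE => /andP[-> /eqP].
have qp : q != p by apply: contraTneq isT => qp; move: Yq; rewrite qp Yp.
have sep' := sep_flat pE uY nY Yp sepE; rewrite -defE' in sep'.
have [Q [uQ nQ Qq]] := sep' q qE'.
have qK : q \notin p |: K by apply/negP=> /(uncutP _ _ _ _ uQ); rewrite Qq.
have neg' : neg_first (q |: (p |: K)) E'.
  move=> Z e uZ; apply: negE'; apply/uncutP=> f fK; apply: (uncutP _ _ _ _ uZ).
  by rewrite inE fK orbT.
have greedyK X e : uncut (q |: (p |: K)) X -> cob X e != 0 ->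
    (forall g, (g < e)%N -> cob X g = 0) -> e \in F.
  move=> uX; apply: gF; apply/uncutP=> f fK; apply: (uncutP _ _ _ _ uX).
  by rewrite inE fK orbT.
have [qF|qF] := boolP (q \in F).
  have -> : F' = F :\ q by rewrite /F' qF.
  split=> //.
  - by move: cF; rewrite (cardsD1 q) qF => -[].
  - rewrite -setI_eq0; apply/eqP/setP=> e; rewrite !inE.
    case: eqVneq => //= _; apply/negP=> /andP[/(disjointFr dF)].
    by rewrite !inE => ->.
  - suff -> : q |: (p |: K) :|: F :\ q = p |: K :|: F by [].
    by rewrite -setUA [_ :|: (F :\ q)]setUC setUA setD1K // setUC.
  - move=> X e uX Xe emin; rewrite inE (greedyK X) // andbT inE.
    by apply: contraNneq Xe => ->; rewrite (uncutP _ _ _ _ uX) // setU11.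
have qpF : q \notin p |: F by rewrite !inE negb_or qp.
have [D0 sD orthD] := fund_cycleP pE gF qE qpF; rewrite -/M in D0 sD orthD.
set D := fund_cycle _ _ _ in D0 sD orthD.
have DF e : e \in D -> e != p -> e != q -> e \in F.
  by move=> /(subsetP sD); rewrite !inE => /orP[/orP[//|->]|->].
(* The cycle has an edge other than [p] and [q]: [Y] cuts [p] but not [q], and [Q] cuts [q] but not
   [p]. *)
have FD0 : F :&: D != set0.
  apply/negP=> /eqP FD0.
  have noF e : e \in D -> (e == p) || (e == q).
    move=> eD; rewrite -[_ || _]negbK negb_or; apply/negP=> /andP[ep eq].
    have : e \in F :&: D by rewrite inE eD andbT DF.
    by rewrite FD0 inE.
  have pD : p \notin D.
    apply/negP=> pD; have [|g [gD gp Yg]] := orthD Y p uY pD; first by rewrite Yp.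
    by have := noF g gD; rewrite (negbTE gp) /= => /eqP gq; rewrite gq Yq eqxx in Yg.
  have qD : q \in D.
    case/set0Pn: D0 => e eD; have := noF e eD => /orP[/eqP ep|/eqP<-//].
    by rewrite -ep eD in pD.
  have uKQ : uncut K Q.
    by apply/uncutP=> f fK; apply: (uncutP _ _ _ _ uQ); rewrite inE fK orbT.
  have [|g [gD gq _]] := orthD Q q uKQ qD; first by rewrite Qq.
  have := noF g gD; rewrite (negbTE gq) orbF => /eqP gp.
  by rewrite -gp gD in pD.
have [] := smaxP q FD0; set f0 := smax _ _ => f0FD f0max.
have [f0F f0D] : f0 \in F /\ f0 \in D by move: f0FD; rewrite inE => /andP[].
have -> : F' = F :\ f0 by rewrite /F' (negbTE qF).
have f0pK : f0 \notin p |: K by rewrite (disjointFr dF f0F).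
split=> //.
- by move: cF; rewrite (cardsD1 f0) f0F => -[].
- rewrite -setI_eq0; apply/eqP/setP=> e; rewrite !inE.
  apply/negP=> /andP[/andP[_ eF]]; case: eqVneq => [eq|_] /=.
    by rewrite eq (negbTE qF) in eF.
  by have := disjointFr dF eF; rewrite !inE => ->.
- have [|Z uZ Zf0] := indepP _ _ _ iF f0; first by rewrite inE f0F orbT.
  suff -> : q |: (p |: K) :|: F :\ f0 = q |: (p |: K :|: F) :\ f0.
    apply: (indep_exchange iF _ uZ Zf0); first by rewrite inE f0F orbT.
    have uKZ e : e \in p |: K -> cob Z e = 0.
      move=> eK; apply: (uncutP _ _ _ _ uZ); rewrite in_setD1 inE eK orTb andbT.
      by apply: contraTneq f0F => <-; rewrite (disjointFl dF eK).
    (* [Z] isolates [f0] in [p |: K :|: F], so its second edge on the cycle can only be [q]. *)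
    have [|g [gD gf0 Zg]] := orthD Z f0 _ f0D Zf0.
      by apply/uncutP=> e eK; apply: uKZ; rewrite inE eK orbT.
    have [<-//|gq] := eqVneq g q.
    have [gp|gp] := eqVneq g p; first by rewrite gp uKZ ?setU11 ?eqxx in Zg.
    move: Zg; rewrite (uncutP _ _ _ _ uZ) ?eqxx // in_setD1 gf0 inE.
    by rewrite (DF g) ?orbT.
  rewrite -setUA; congr (_ |: _); rewrite setDUl; congr (_ :|: _).
  by apply/esym/setDidPl; rewrite disjoint_sym disjoints1.
(* Here the choice of a maximum matters: a cut with least edge [f0] would meet the cycle in another
   edge of [F], which is smaller. *)
- move=> X e uX Xe emin; have eF := greedyK X e uX Xe emin; rewrite in_setD1 eF andbT.
  apply: contraNneq Xe => ef0; apply/eqP; rewrite ef0 in emin *.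
  apply/eqP/negPn/negP=> Xf0.
  have [|g [gD gf0 Xg]] := orthD X f0 _ f0D Xf0.
    by apply/uncutP=> h hK; apply: (uncutP _ _ _ _ uX); rewrite !inE hK !orbT.
  have gF' : g \in F.
    apply: DF => //; apply: contraNneq Xg => ->; apply/eqP;
      by apply: (uncutP _ _ _ _ uX); rewrite !inE eqxx ?orbT.
  have : (g < f0)%N by rewrite ltn_neqAle val_eqE gf0 f0max // inE gF'.
  by move/emin=> Xg0; rewrite Xg0 eqxx in Xg.
Qed.

End Step.

(** * Correctness *)

Section Correctness.
Variables (V : finType) (m : nat) (tl hd : 'I_m -> V).
Implicit Types (A B D K E F S T : {set 'I_m}) (X Y Z W : {set V}).
Implicit Types (e f g p q : 'I_m) (C : sset m).

Local Notation cob := (coboundary tl hd).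
Local Notation uncut := (uncut tl hd).
Local Notation nonneg := (nonneg tl hd).
Local Notation spans := (spans tl hd).
Local Notation G := (G0 tl hd).
Local Notation state := (state tl hd).

(** By [fc_one] and [fc_zero] the sets [X t] are shores of fundamental cuts of [p :: ts] over the
    contraction of [K]. [fc_neg] prepares the sign condition on cocycles, [fc_cover] the one on
    cycles. *)
Record fundamental_cuts K p E (ts : seq 'I_m) (X : 'I_m -> {set V}) : Prop := FundamentalCuts {
  fc_uncut : forall t, t \in p :: ts -> uncut K (X t);
  fc_one : forall t, t \in p :: ts -> cob (X t) t = 1%R;
  fc_zero : forall s t, s \in p :: ts -> t \in p :: ts -> s != t -> cob (X t) s = 0;
  fc_neg : forall t e, t \in ts -> cob (X t) e != 0 ->
    (forall g, (g < e)%N -> cob (X t) g = 0) -> (cob (X t) e < 0)%R;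
  fc_nonneg : nonneg E (X p);
  fc_cover : forall e, e \in E -> exists t, [/\ t \in p :: ts, cob (X t) e = 1%R, (t <= e)%N &
    forall s, s \in p :: ts -> (s < t)%N -> cob (X s) e = 0];
  fc_sub : {subset ts <= E};
  fc_path : path (fun a b : 'I_m => (a < b)%N) p ts;
  fc_spans : spans (K :|: [set x in p :: ts]) }.

Lemma run_fundamental n K p E F : state n K p E F ->
  exists X : 'I_m -> {set V}, fundamental_cuts K p E (run tl hd n K p E F) X.
Proof.
elim: n K p E F => [|n IHn] K p E F st /=.
  case: st => pE pmin /cards0_eq-> _ _ gF sepE _.
  (* With [F] empty, all cuts through [p] avoiding [K] agree up to sign, so the one chosen contains
     every ground edge positively. *)
  have sK : spans (p |: K) by have := greedy_spans gF; rewrite setU0.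
  have [X [uX nX Xp]] := sepE p pE; exists (fun=> X); split=> //.
  - by move=> t; rewrite inE => /eqP->.
  - by move=> s t; rewrite !inE => /eqP-> /eqP->; rewrite eqxx.
  - move=> e eE; exists p; split; rewrite ?mem_head ?pmin //; last first.
      by move=> s; rewrite inE => /eqP->; rewrite ltnn.
    have [Y [uY nY Ye]] := sepE e eE.
    have Yp : cob Y p = 1%R.
      have := cob_bound tl hd Y p; have := nonnegP _ _ _ _ nY p pE.
      have [Yp|] := eqVneq (cob Y p) 0; last by lia.
      by move: Ye; rewrite (spansP _ _ _ sK) //; apply: uncutU1.
    rewrite -Ye; apply: (spans_cob_eq sK) => f /setU1P[->|fK]; first by rewrite Xp Yp.
    by rewrite (uncutP _ _ _ _ uX) ?(uncutP _ _ _ _ uY).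
  - suff -> : K :|: [set x in [:: p]] = p |: K by [].
    by apply/setP=> x; rewrite !inE orbC.
have [pE pmin] := (state_mem st, state_min st).
have := run_step st; rewrite /=.
set E' := E :\: _; set q := smin E' p; set F' := if _ then _ else _.
case=> Y [[uY nY Yp defE'] [negE' st']].
have [X [X1 X2 X3 X4 X5 X6 X7 X8 X9]] := IHn _ _ _ _ st'.
have qE' := state_mem st'.
set ts := run _ _ _ _ _ _ _ in X1 X2 X3 X4 X5 X6 X7 X8 X9 *.
have tsE' : {subset q :: ts <= E'} by move=> t; rewrite inE => /orP[/eqP->|/X7].
have E'E e : e \in E' -> e \in E /\ cob Y e = 0 by rewrite defE' inE => /andP[? /eqP].
have ts_p t : t \in q :: ts -> t != p.
  by move=> /tsE'/E'E[_ Yt]; apply: contraTneq isT => tp; move: Yt; rewrite tp Yp.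
have lt_pts t : t \in q :: ts -> (p < t)%N.
  move=> tq; rewrite ltn_neqAle pmin ?andbT; last by case: (E'E t (tsE' t tq)).
  by rewrite val_eqE eq_sym ts_p.
exists (fun t => if t == p then Y else X t); split.
- move=> t; rewrite inE; case: eqVneq => //= _ /X1 uX.
  by apply/uncutP=> e eK; apply: (uncutP _ _ _ _ uX); rewrite inE eK orbT.
- by move=> t; rewrite inE; case: eqVneq => [->|_] //= /X2.
- move=> s t; rewrite [s \in _]inE [t \in _]inE; case: (eqVneq t p) => [->|tp] /=.
    by case: eqVneq => //= _ /tsE'/E'E[].
  case: (eqVneq s p) => [->|sp] /= => [_ /X1 uX _|]; last exact: X3.
  by apply: (uncutP _ _ _ _ uX); rewrite setU11.
- move=> t e tq; rewrite (negbTE (ts_p t tq)) => Xe emin.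
  move: tq; rewrite inE => /orP[/eqP tq|tts]; last exact: X4.
  (* The recursion gives no sign for its own infinity edge [q], only nonnegativity of its cut; the
     invariant supplies the sign. *)
  by subst t; apply: (negE' (X q)) => //; apply: X1; rewrite mem_head.
- by rewrite eqxx.
(* An edge cut by [Y] leaves the ground set now and is covered by [p]; the others are left to the
   recursion. *)
- move=> e eE; have [Ye|Ye] := eqVneq (cob Y e) 0; last first.
    exists p; rewrite mem_head eqxx pmin //; split=> //.
      by have := cob_bound tl hd Y e; have := nonnegP _ _ _ _ nY e eE; move: Ye; clear; lia.
    by move=> s; rewrite inE => /orP[/eqP->|/lt_pts/ltnW]; rewrite ?ltnn // leqNgt => /negbTE->.
  have [|t [tq Xt te tmin]] := X6 e; first by rewrite defE' inE eE Ye.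
  exists t; rewrite inE tq orbT (negbTE (ts_p t tq)); split=> // s.
  by rewrite inE; case: eqVneq => //= _; apply: tmin.
- by move=> t /tsE'/E'E[].
- by rewrite /= lt_pts ?mem_head.
- suff <- : p |: K :|: [set x in q :: ts] = K :|: [set x in [:: p, q & ts]] by [].
  by apply/setP=> x; rewrite !inE -!orbA orbCA.
Qed.

(** * Acyclic and bipolar digraphs *)

Section Bipolar.
Hypothesis acG : acyclic G.

(** No edge enters the set of vertices from which the tail of [e] is reachable, and by acyclicity
    the head of [e] lies outside. *)
Lemma acyclic_sep e : exists X, [/\ uncut set0 X, nonneg setT X & cob X e = 1%R].
Proof.
exists [set v | connect (dadj G) v (tl e)]; split.
- by apply/uncutP=> f; rewrite inE.
- apply/nonnegP=> f _; rewrite /coboundary !inE.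
  have /connect1/connect_trans H : dadj G (tl f) (hd f).
    by apply/existsP; exists f; rewrite inE !eqxx.
  by case: (boolP (connect _ (hd f) _)) => [/H->|_] //; case: (connect _ _ _).
- have := acyclic_dadj acG (in_setT e : e \in eset G).
  by rewrite /coboundary !inE connect0 => /negbTE->.
Qed.

Definition ancestors v := [set u | connect (dadj G) u v].

(** The number of ancestors thus increases along edges and serves as a topological rank. *)
Lemma ancestors_proper f : ancestors (tl f) \proper ancestors (hd f).
Proof.
have th : dadj G (tl f) (hd f) by apply/existsP; exists f; rewrite inE !eqxx.
apply/properP; split.
  by apply/subsetP=> u; rewrite !inE => /connect_trans; apply; apply: connect1.
exists (hd f); first by rewrite inE connect0.
by rewrite inE; apply: (acyclic_dadj acG (in_setT f : f \in eset G)).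
Qed.

Variable p : 'I_m.
Hypothesis sourceP : forall v, v \in vset G -> (is_source G v <-> v = tailv G p).
Hypothesis sinkP : forall v, v \in vset G -> (is_sink G v <-> v = headv G p).

(** No edge enters [Z], so a vertex of least rank in [Z] is a source and one of greatest rank
    outside is a sink; these are the ends of [p]. *)
Lemma bipolar_directed_cut Z e : nonneg setT Z -> cob Z e != 0 -> cob Z p != 0.
Proof.
move=> /nonnegP nZ Ze.
have [eZ eZ'] : tl e \in Z /\ hd e \notin Z.
  have := nZ e (in_setT e); move: Ze; rewrite /coboundary.
  by case: (_ \in Z); case: (_ \in Z).
have step f : (hd f \in Z) ==> (tl f \in Z).
  by have := nZ f (in_setT f); rewrite /coboundary; case: (_ \in Z); case: (_ \in Z).
have pZ : tl p \in Z.
  case: (@arg_minnP _ (tl e) (fun v => v \in Z) (fun v => #|ancestors v|) eZ) => v vZ vmin.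
  suff /(sourceP (in_setT v)) vE : is_source G v by have {}vE : v = tl p := vE; rewrite -vE.
  move=> f _; apply: contraTneq vZ => /= fv; rewrite -fv.
  apply/negP=> /(implyP (step f))/vmin; rewrite -fv leqNgt.
  by rewrite (proper_card (ancestors_proper f)).
have pZ' : hd p \notin Z.
  case: (@arg_maxnP _ (hd e) (fun v => v \notin Z) (fun v => #|ancestors v|) eZ') => v vZ vmax.
  suff /(sinkP (in_setT v)) vE : is_sink G v by have {}vE : v = hd p := vE; rewrite -vE.
  move=> f _; apply: contraNneq vZ => /= fv; rewrite -fv; apply: contraTT isT => fZ.
  have fZ' : hd f \notin Z by apply: contra fZ => /(implyP (step f)).
  by have := vmax _ fZ'; rewrite /= -fv leqNgt (proper_card (ancestors_proper f)).
by rewrite /coboundary pZ (negbTE pZ').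
Qed.

End Bipolar.

Lemma initial_state p : connected G -> bipolar G p -> (forall e, (p <= e)%N) ->
  state (#|T0 tl hd|).-1 set0 p setT (T0 tl hd :\ p).
Proof.
move=> conG [_ acG srcP snkP] pmin; set T := T0 tl hd.
have lT := T0_lexmin conG; rewrite -/T in lT.
have gT := lexmin_greedy conG lT.
have /(spanning_treeP conG)/andP[_ iT] : spanning_tree G T by case: lT.
have [X [uX nX Xp]] := acyclic_sep acG p.
(* As the least edge overall, [p] is least in any cut that contains it. *)
have pT : p \in T by apply: (gT X) => [||g]; rewrite ?Xp // ltnNge pmin.
split=> //.
- by rewrite inE.
- by rewrite (cardsD1 p T) pT.
- by rewrite setU0 disjoint_sym disjoints1 !inE eqxx.
- by rewrite setU0 setD1K.
- move=> Y e uY Ye emin; rewrite inE (gT Y) // ?andbT.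
    by rewrite inE; apply: contraNneq Ye => ->; rewrite (uncutP _ _ _ _ uY) // setU11.
  by apply/uncutP=> f; rewrite inE.
- by move=> e _; apply: acyclic_sep.
(* The invariant holds vacuously: every nonempty nonnegative cut contains [p]. *)
- move=> Z e uZ nZ Ze _; have := bipolar_directed_cut acG srcP snkP nZ Ze.
  by rewrite (uncutP _ _ _ _ uZ) ?setU11 ?eqxx.
Qed.

Lemma fundamental_cuts_fully_optimal p ts (X : 'I_m -> {set V}) : connected G ->
  fundamental_cuts set0 p setT ts X -> fully_optimal G p (p |: [set e | e \in ts]).
Proof.
move=> conG [_ X1 X0 Xneg _ Xcover _ _]; set T := p |: _.
have TE e : (e \in T) = (e \in p :: ts) by rewrite !inE.
have -> : set0 :|: [set x in p :: ts] = T by apply/setP=> x; rewrite TE !inE.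
move=> sT; split.
- apply/(spanning_treeP conG); rewrite sT; apply/indepP=> f; rewrite TE => fT.
  exists (X f); last by rewrite X1.
  by apply/uncutP=> e; rewrite in_setD1 TE => /andP[ef eT]; apply: X0.
- move=> b C bT bp [Y [_ _ CY]] sC bC.
  have CE e : (e \in C.1) = (cob Y e == 1%R).
    by rewrite CY !inE /coboundary /=; do 2! case: (_ \in Y).
  have CE' e : (e \in C.2) = (cob Y e == - 1%R)%R.
    by rewrite CY !inE /coboundary /=; do 2! case: (_ \in Y).
  have suppE e : (e \in supp C) = (cob Y e != 0).
    by rewrite inE CE CE'; have := cob_bound tl hd Y e; lia.
  (* The two coboundaries agree on the spanning set [T]: both are 1 at [b] and 0 at its other
     edges. *)
  have YX : forall e, cob Y e = cob (X b) e.
    apply: (spans_cob_eq sT) => e eT; have [->|eb] := eqVneq e b.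
      by rewrite X1 -?TE //; apply/eqP; rewrite -CE.
    rewrite X0 -?TE //; apply/eqP/negPn/negP; rewrite -suppE => /(subsetP sC).
    by rewrite !inE (negbTE eb) orbF -[_ || _](TE e) eT.
  have [|f Xf fmin] := @first_cut _ _ tl hd (X b) b; first by rewrite X1 -?TE.
  have bts : b \in ts by move: bT; rewrite TE inE (negbTE bp).
  exists f.
    by rewrite CE' YX; have := Xneg b f bts Xf fmin; have := cob_bound tl hd (X b) f; lia.
  split=> [|g]; rewrite suppE YX // => Xg; rewrite leqNgt; apply/negP=> /fmin gf.
  by rewrite gf eqxx in Xg.
- move=> e C; rewrite inE => /andP[eT _] cC sC eC.
  have eS : e \in supp C by rewrite inE eC.
  have CT f : f \in supp C -> f != e -> f \in T.
    by move=> /(subsetP sC); rewrite in_setU in_set1 => /orP[//|/eqP->]; rewrite eqxx.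
  (* [t] is the first tree edge whose fundamental cut contains [e]. Apart from [e] this cut can meet
     the cycle only in [t], so orthogonality makes [t] negative. *)
  have [t [tT Xte te tmin]] := Xcover e (in_setT e).
  have dC : [disjoint C.1 & C.2] by case: cC => ? [? [_ []]].
  have [|g gC Hg] := cycle_cut_orthogonal (X := X t) cC eS; first by rewrite /= -/(cob _ _) Xte.
  have {}Hg : (cobt G C (X t) g = - 1)%R.
    by rewrite Hg /cobt eC -[coboundary _ _ _ _]/(cob (X t) e) Xte.
  have ge : g != e.
    apply: contraTneq isT => ge; move: Hg.
    by rewrite ge /cobt eC -[coboundary _ _ _ _]/(cob (X t) e) Xte.
  have gt : g = t.
    apply/eqP/negPn/negP=> gt; move: Hg; rewrite /cobt -[coboundary _ _ _ _]/(cob (X t) g).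
    have gT : g \in p :: ts by rewrite -TE CT.
    by rewrite (X0 g t gT tT gt); case: (g \in C.1).
  subst g; exists t.
    move: Hg; rewrite /cobt -[coboundary _ _ _ _]/(cob (X t) t) X1 //; case: ifP => // tC1 _.
    by move: gC; rewrite inE tC1.
  (* A smaller tree edge [s] on the cycle would have [e] in its fundamental cut, against the choice
     of [t]. *)
  split=> // s sS; have [->//|se] := eqVneq s e.
  have sT' : s \in p :: ts by rewrite -TE CT.
  rewrite leqNgt; apply/negP=> st.
  have [|h [hC hs Xh]] := cycle_cut_orthogonal_neq (X := X s) cC sS.
    by rewrite /= -/(cob _ _) X1.
  have {}Xh : cob (X s) h != 0 := Xh.
  have [he|he] := eqVneq h e; first by rewrite he tmin // eqxx in Xh.
  have hT : h \in p :: ts by rewrite -TE CT.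
  by rewrite (X0 h s hT sT' hs) eqxx in Xh.
Qed.

End Correctness.

Theorem theorem4p3 (V : finType) (m : nat) (tl hd : 'I_m -> V) (p : 'I_m) :
  connected (G0 tl hd) ->
  bipolar (G0 tl hd) p ->
  (forall e : 'I_m, (p <= e)%N) ->
  sorted (fun a b : 'I_m => (a < b)%N) (p :: alg_ts tl hd p) /\
  fully_optimal (G0 tl hd) p (p |: [set e | e \in alg_ts tl hd p]).
Proof.
move=> conG bipG pmin.
have [X fcX] := run_fundamental (initial_state conG bipG pmin).
split; first exact: fc_path fcX.
exact: fundamental_cuts_fully_optimal conG fcX.
Qed.
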